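(* Let $X$ and $Y$ be completely regular spaces. (i) Let $\mu_1,\mu_2\in\mathcal{P}_r(X)$, $\nu\in\mathcal{P}_r(Y)$, and let $\alpha$ and $\beta$ be continuous nonnegative functions on $X^2=X\times X$ and $Y^2=Y\times Y$, respectively, where $\beta(y,y)=0$ for all $y\in Y$. Then for every measure $\sigma_1\in\Pi(\mu_1,\nu)$ there exists a measure $\sigma_2\in\Pi(\mu_2,\nu)$ such that $$K_{\alpha\oplus\beta}(\sigma_1,\sigma_2)\le K_\alpha(\mu_1,\mu_2).$$ (ii) Let $\alpha$ and $\beta$ be continuous pseudometrics on $X$ and $Y$, respectively, let $\mu_1,\mu_2\in\mathcal{P}_r(X)$ be such that $x\mapsto\alpha(x,x_0)$ is integrable with respect to $\mu_1$ and $\mu_2$ for some $x_0\in X$, and let $\nu_1,\nu_2\in\mathcal{P}_r(Y)$ be such that $y\mapsto\beta(y,y_0)$ is integrable with respect to $\nu_1$ and $\nu_2$ for some $y_0\in Y$. Then for every measure $\sigma_1\in\Pi(\mu_1,\nu_1)$ there exists a measure $\sigma_2\in\Pi(\mu_2,\nu_2)$ such that $$d_{K,\alpha\oplus\beta}(\sigma_1,\sigma_2)\le d_{K,\alpha}(\mu_1,\mu_2)+d_{K,\beta}(\nu_1,\nu_2).$$ Hence $$H_{K,\alpha\oplus\beta}(\Pi(\mu_1,\nu_1),\Pi(\mu_2,\nu_2))\le d_{K,\alpha}(\mu_1,\mu_2)+d_{K,\beta}(\nu_1,\nu_2).$$ (iii) Let $X_1,\dots,X_n$ be completely regular spaces,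 let $\alpha_i$ be a continuous pseudometric on $X_i$, and let $\mu_i,\nu_i\in\mathcal{P}_r(X_i)$ be such that $x\mapsto\alpha_i(x,x_i^0)$ is integrable with respect to $\mu_i$ and $\nu_i$ for some $x_i^0\in X_i$, $i=1,\dots,n$. Then for every $\sigma\in\Pi(\mu_1,\dots,\mu_n)$ there exists a measure $\pi\in\Pi(\nu_1,\dots,\nu_n)$ such that $$d_{K,\alpha_1\oplus\cdots\oplus\alpha_n}(\pi,\sigma)\le d_{K,\alpha_1}(\mu_1,\nu_1)+\cdots+d_{K,\alpha_n}(\mu_n,\nu_n).$$
   Context: Completely regular spaces are Hausdorff. $\mathcal{P}_r(Z)$ is the set of Radon probability measures on $Z$: Borel probability measures $\mu$ such that for every Borel set $B$ and $\varepsilon>0$ there is a compact set $K\subset B$ with $\mu(B\setminus K)<\varepsilon$. Products carry the product topology and its Borel $\sigma$-algebra. For $\mu\in\mathcal{P}_r(X)$, $\nu\in\mathcal{P}_r(Y)$, $\Pi(\mu,\nu)$ is the set of Radon probability measures $\sigma$ on $X\times Y$ with projections (marginals) $\mu$ and $\nu$, that is, $\sigma(A\times Y)=\mu(A)$, $\sigma(X\times B)=\nu(B)$ for all Borel $A\subset X$, $B\subset Y$. Similarly $\Pi(\mu_1,\dots,\mu_n)$ is the set of Radon probability measures on $X_1\times\cdots\times X_n$ with projections $\mu_1,\dots,\mu_n$ on the factors. For a nonnegative Borel function $h$ on $X\times Y$ set $K_h(\mu,\nu)=\inf_{\sigma\in\Pi(\mu,\nu)}\int h\,d\sigma\in[0,+\infty]$.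 In particular, for a function $\alpha$ on $X\times X$ and $\mu_1,\mu_2\in\mathcal{P}_r(X)$ this defines $K_\alpha(\mu_1,\mu_2)$. For functions $\alpha_i$ on $X_i\times X_i$, $i=1,\dots,n$, the function $\alpha_1\oplus\cdots\oplus\alpha_n$ on $(X_1\times\cdots\times X_n)^2$ is $$(\alpha_1\oplus\cdots\oplus\alpha_n)((x_1,\dots,x_n),(x_1',\dots,x_n'))=\alpha_1(x_1,x_1')+\cdots+\alpha_n(x_n,x_n').$$ So $K_{\alpha\oplus\beta}(\sigma_1,\sigma_2)$ is the Kantorovich cost between two measures on $X\times Y$. A pseudometric differs from a metric in that $d(x,y)=0$ is allowed for $x\ne y$. For a continuous pseudometric $d$ on a space $Z$ and $\mu,\nu\in\mathcal{P}_r(Z)$ with respect to which $z\mapsto d(z,z_0)$ is integrable, the Kantorovich pseudometric is $$d_{K,d}(\mu,\nu)=\sup\Bigl\{\int f\,d(\mu-\nu)\colon |f(z)-f(z')|\le d(z,z')\ \forall z,z'\in Z\Bigr\}.$$ $H_{K,\alpha\oplus\beta}$ is the Hausdorff pseudometric generated by $d_{K,\alpha\oplus\beta}$: $H(A,B)=\max\{\sup_{a\in A}\inf_{b\in B}d_{K,\alpha\oplus\beta}(a,b),\ \sup_{b\in B}\inf_{a\in A}d_{K,\alpha\oplus\beta}(a,b)\}$. *)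

(* Defs.v *)
From HB Require Import structures.
From mathcomp Require Import all_boot all_order all_algebra.
From mathcomp Require Import all_classical all_reals all_analysis.
Import numFieldNormedType.Exports.

Set Implicit Arguments.
Unset Strict Implicit.
Unset Printing Implicit Defensive.

Import Order.TTheory GRing.Theory Num.Theory.

Local Open Scope classical_set_scope.
Local Open Scope ring_scope.
Local Open Scope ereal_scope.

HB.instance Definition _ (X Y : ptopologicalType) := Pointed.on (X * Y)%type.
HB.instance Definition _ (I : Type) (X : I -> ptopologicalType) :=
  Pointed.on (prod_topology X).

(* The completely regular spaces are Hausdorff by convention;
   [completely_regular_space] alone does not include this. *)
Definition tychonoff_space (T : topologicalType) : Prop :=
  completely_regular_space T /\ hausdorff_space T.

(* On a product, [borel (X * Y)] carries the Borel sigma-algebra of the product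
   topology. It may be strictly larger than the product sigma-algebra, which is
   the one the library attaches to [borel X * borel Y].
   Measurable types are pointed, whence the use of [ptopologicalType]; a space
   carrying a probability measure is nonempty, so no generality is lost. *)
Notation borel T := (g_sigma_algebraType (@open T)).

Section kantorovich.
Context {R : realType}.

Definition radon (T : ptopologicalType) (mu : probability (borel T) R) : Prop :=
  forall B : set (borel T), measurable B -> forall e : R, (0 < e)%R ->
    exists K : set T, [/\ compact K, K `<=` B & mu (B `\` K) < e%:E].

Definition coupling (X Y : ptopologicalType) (mu : probability (borel X) R)
    (nu : probability (borel Y) R) : set (probability (borel (X * Y)%type) R) :=
  [set sigma | [/\ radon sigma,
     forall A : set (borel X), measurable A -> sigma (A `*` setT) = mu A &
     forall B : set (borel Y), measurable B -> sigma (setT `*` B) = nu B]].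

Definition multicoupling (n : nat) (X : 'I_n -> ptopologicalType)
    (mu : forall i, probability (borel (X i)) R) :
    set (probability (borel (prod_topology X)) R) :=
  [set sigma | radon sigma /\
     forall i (A : set (borel (X i))), measurable A ->
       sigma [set x : prod_topology X | A (x i)] = mu i A].

Definition kantorovich_cost (X Y : ptopologicalType) (h : X * Y -> R)
    (mu : probability (borel X) R) (nu : probability (borel Y) R) : \bar R :=
  ereal_inf [set \int[sigma]_z (h z)%:E | sigma in coupling mu nu].

Definition oplus (X Y : Type) (alpha : X * X -> R) (beta : Y * Y -> R) :
    (X * Y) * (X * Y) -> R :=
  fun p => (alpha (p.1.1, p.2.1) + beta (p.1.2, p.2.2))%R.

Definition multioplus (n : nat) (X : 'I_n -> ptopologicalType)
    (alpha : forall i, X i * X i -> R) :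
    prod_topology X * prod_topology X -> R :=
  fun p => (\sum_(i < n) alpha i (p.1 i, p.2 i))%R.

Definition pseudometric (T : Type) (d : T * T -> R) : Prop :=
  [/\ forall x y, (0 <= d (x, y))%R,
      forall x, d (x, x) = 0%R,
      forall x y, d (x, y) = d (y, x) &
      forall x y z, (d (x, z) <= d (x, y) + d (y, z))%R].

Definition dist_integrable (T : ptopologicalType) (d : T * T -> R)
    (mu : probability (borel T) R) (x0 : T) : Prop :=
  mu.-integrable setT (fun x => (d (x, x0))%:E).

(* The supremum is taken in the extended reals. If [d] is continuous, the
   functions [f] below are continuous, hence Borel, and they are integrable as
   soon as [dist_integrable] holds for [mu] and [nu] (for some base point). *)
Definition kantorovich_dist (T : ptopologicalType) (d : T * T -> R)
    (mu nu : probability (borel T) R) : \bar R :=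
  ereal_sup [set \int[mu]_z (f z)%:E - \int[nu]_z (f z)%:E | f in
    [set f : T -> R | forall z z', (`|f z - f z'| <= d (z, z'))%R]].

Definition hausdorff_dist (M : Type) (d : M -> M -> \bar R) (A B : set M) :
    \bar R :=
  maxe (ereal_sup [set ereal_inf [set d a b | b in B] | a in A])
       (ereal_sup [set ereal_inf [set d a b | a in A] | b in B]).

End kantorovich.

(* Main.v *)
(* The measures are obtained from a Hahn-Banach argument rather than from
   disintegrations or from the attainment of optimal plans. Fix a convex cone of
   pairs [(G, c)], read as "the function [G] on Z has price at most [c]". If it
   contains no arbitrage (no [G >= 0] with [c < 0]), a maximal such cone prices
   every bounded function linearly; if moreover the complements of suitable
   compact sets have small prices, the induced finitely additive set function
   yields a Radon probability gamma with [\int G dgamma <= c] for all bounded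
   lower semicontinuous G of the cone. Pricing the functions of one coordinate
   by their integrals prescribes the marginals of gamma.

   For (i), Z = (X * Y) * X, functions of (x, y) are priced by sigma1, functions
   of x' by mu2, and alpha(x, x') costs K_alpha(mu1, mu2): this glues sigma1 to
   mu2, and the law of (x', y) is the required sigma2. The absence of arbitrage
   follows by integrating the infimum over x' of the total payoff, which is upper
   semicontinuous in x.

   For (ii) and (iii), Z is the product, functions of one coordinate are priced
   by the target marginals, and - f, for f 1-Lipschitz, costs
   sum_i d_K(mu_i, nu_i) - \int f dsigma. The absence of arbitrage reduces to
   the fact that if f(x) <= sum_i phi_i(x_i) with f Lipschitz, then the phi_i
   can be decreased to Lipschitz functions. *)
Require Import Defs.
From HB Require Import structures.
From mathcomp Require Import all_boot all_order all_algebra.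
From mathcomp Require Import all_classical all_reals all_analysis.
From mathcomp Require Import measurable_realfun ring lra.
Import numFieldNormedType.Exports.

Set Implicit Arguments.
Unset Strict Implicit.
Unset Printing Implicit Defensive.

Import Order.TTheory GRing.Theory Num.Theory.

Local Open Scope classical_set_scope.
Local Open Scope ring_scope.

Definition is_bounded (R : realType) (T : Type) (F : T -> R) :=
  exists M, forall z, `|F z| <= M.

(** * Linear extensions of prices *)

Section is_bounded_lemmas.
Context {R : realType} {T : Type}.
Implicit Types f g : T -> R.

Lemma is_boundedD f g : is_bounded f -> is_bounded g ->
  is_bounded (fun x => f x + g x).
Proof.
move=> [A fA] [B gB]; exists (A + B) => z.
by rewrite (le_trans (ler_normD _ _))// lerD.
Qed.

Lemma is_boundedM f g : is_bounded f -> is_bounded g ->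
  is_bounded (fun x => f x * g x).
Proof.
by move=> [A fA] [B gB]; exists (A * B) => z; rewrite normrM ler_pM.
Qed.

Lemma is_boundedN f : is_bounded f -> is_bounded (fun x => - f x).
Proof. by move=> [A fA]; exists A => z; rewrite normrN. Qed.

Lemma is_bounded_cst (c : R) : is_bounded (cst c : T -> R).
Proof. by exists `|c|. Qed.

Lemma is_bounded_indic (A : set T) : is_bounded (\1_A : T -> R).
Proof. by exists 1 => z; rewrite indicE ger0_norm// lern1 leq_b1. Qed.

Lemma is_bounded_sum (I : Type) (s : seq I) (F : I -> T -> R) :
  (forall i, is_bounded (F i)) -> is_bounded (fun x => \sum_(i <- s) F i x).
Proof.
move=> bF; elim: s => [|i s [M IH]].
  by exists 0 => z; rewrite big_nil normr0.
have [M' iM'] := bF i; exists (M' + M) => z.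
by rewrite big_cons (le_trans (ler_normD _ _))// lerD.
Qed.

End is_bounded_lemmas.

Section price_cone.
Context {R : realType} {T : Type}.
Implicit Types (C : set ((T -> R) * R)) (F G : T -> R) (a b c d t : R).

(* [C (F, c)] reads: the payoff [F] can be dominated at the price [c]; the last
   condition is the absence of arbitrage. *)
Definition price_cone C :=
  [/\ forall c, C (cst c, c),
      forall F a G b, C (F, a) -> C (G, b) -> C (fun z => F z + G z, a + b),
      forall t F a, 0 <= t -> C (F, a) -> C (fun z => t * F z, t * a) &
      forall F a, C (F, a) -> (forall z, 0 <= F z) -> 0 <= a].

Definition downward C :=
  forall F a G b, C (G, b) -> (forall z, F z <= G z) -> b <= a -> C (F, a).

(** A nonnegative payoff of the enlarged cone lies below one of [C], which is then nonnegative too,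
    so no arbitrage appears. *)
Lemma price_cone_downward C : price_cone C ->
  exists C', [/\ price_cone C', downward C' & C `<=` C'].
Proof.
move=> [C1 CD CM C0].
exists [set p | exists G b, [/\ C (G, b), forall z, p.1 z <= G z & b <= p.2]].
split.
- split.
  + by move=> c; exists (cst c), c.
  + move=> F a G b [F' [a' [CF FF' aa']]] [G' [b' [CG GG' bb']]].
    exists (fun z => F' z + G' z), (a' + b'); split; first exact: CD.
    * by move=> z /=; apply: lerD.
    * exact: lerD.
  + move=> t F a t0 [F' [a' [CF FF' aa']]].
    exists (fun z => t * F' z), (t * a'); split; first exact: CM.
    * by move=> z /=; apply: ler_wpM2l.
    * exact: ler_wpM2l.
  + move=> F a [F' [a' [CF FF' aa']]] F0; apply: (le_trans _ aa').
    by apply: C0 CF _ => z; apply: le_trans (FF' z).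
- move=> F a G b [F' [a' [CF FF' aa']]] FG ba; exists F', a'; split => //=.
  + by move=> z; apply: le_trans (FG z) (FF' z).
  + exact: le_trans aa' ba.
- by move=> [F a] CFa; exists F, a.
Qed.

(** One Hahn-Banach step: selling [F] at [p] becomes possible. If [G - t F] is nonnegative with
    [t > 0], then [t^-1 G] dominates [F] and costs at least [p]. *)
Lemma price_cone_add C F p : price_cone C -> downward C ->
  (forall G b, C (G, b) -> (forall z, F z <= G z) -> p <= b) ->
  exists C', [/\ price_cone C', downward C', C `<=` C' &
                 C' (fun z => - F z, - p)].
Proof.
move=> [C1 CD CM C0] Cd Fp.
exists [set q | exists t G b, [/\ 0 <= t, C (G, b),
  forall z, q.1 z <= G z - t * F z & b - t * p <= q.2]].
split.
- split.
  + move=> c; exists 0, (cst c), c; split => //= [z|]; by rewrite mul0r subr0.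
  + move=> F1 a F2 b [t [G [c [t0 CG FG ca]]]] [t' [G' [c' [t0' CG' FG' ca']]]].
    exists (t + t'), (fun z => G z + G' z), (c + c'); split.
    * exact: addr_ge0.
    * exact: CD.
    * by move=> z /=; have := FG z; have := FG' z => /=; lra.
    * by move: ca ca' => /=; lra.
  + move=> s F1 a s0 [t [G [c [t0 CG FG ca]]]].
    exists (s * t), (fun z => s * G z), (s * c); split.
    * exact: mulr_ge0.
    * exact: CM.
    * move=> z /=; have := ler_wpM2l s0 (FG z) => /=; lra.
    * by have := ler_wpM2l s0 ca => /=; lra.
  + move=> F1 a [t [G [c [t0 CG FG ca]]]] F10; apply: (le_trans _ ca).
    move: t0; rewrite le_eqVlt => /predU1P[t0|t0].
      move: FG; rewrite -t0 mul0r subr0 => FG; apply: C0 CG _ => z.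
      by apply: le_trans (F10 z) (le_trans (FG z) _); rewrite mul0r subr0.
    have ti : 0 <= t^-1 by rewrite invr_ge0 ltW.
    have := Fp _ _ (CM _ _ _ ti CG).
    rewrite subr_ge0 ler_pdivlMl//; apply => z; rewrite ler_pdivlMl//.
    by have := FG z; have := F10 z => /=; lra.
- move=> F1 a G b [t [G1 [c [t0 CG FG ca]]]] FG1 ba; exists t, G1, c; split => //=.
  + by move=> z; apply: le_trans (FG1 z) (FG z).
  + exact: le_trans ca ba.
- move=> [G b] CG; exists 0, G, b; split => //= [z|]; by rewrite mul0r subr0.
- exists 1, (cst 0), 0; split => //= [z|]; by rewrite mul1r add0r.
Qed.

(** Zorn's lemma above the downward closure of [C]: each condition on a cone involves at most two of
    its members, hence passes to the union of a chain. *)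
Lemma maximal_price_cone C : price_cone C -> exists M,
  [/\ price_cone M, downward M, C `<=` M &
      forall M', price_cone M' -> downward M' -> M `<=` M' -> M' `<=` M].
Proof.
move=> /price_cone_downward[C' [pC' dC' CC']].
pose P := [set M : set ((T -> R) * R) | M !=set0 ->
             [/\ price_cone M, downward M & C' `<=` M]].
have [F FP totF [p0 [X0 FX0 X0p]]|M [PM maxM]] := @Zorn_bigcup _ P.
  have FPr X p : F X -> X p -> [/\ price_cone X, downward X & C' `<=` X].
    by move=> FX Xp; apply: FP FX _; exists p.
  have [pX0 dX0 CX0] := FPr _ _ FX0 X0p.
  split; first split.
  - by move=> c; exists X0 => //; have [+ _ _ _] := pX0; apply.
  - move=> G a H b [X FX Xa] [Y FY Yb]; have [XY|YX] := totF _ _ FX FY.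
    + exists Y => //; have [[_ + _ _] _ _] := FPr _ _ FY Yb.
      by apply => //; exact: XY.
    + exists X => //; have [[_ + _ _] _ _] := FPr _ _ FX Xa.
      by apply => //; exact: YX.
  - move=> t G a t0 [X FX Xa]; exists X => //.
    by have [[_ _ + _] _ _] := FPr _ _ FX Xa; apply.
  - move=> G a [X FX Xa]; have [[_ _ _ +] _ _] := FPr _ _ FX Xa.
    by apply.
  - move=> G a H b [X FX Xa] GH ba; exists X => //.
    by have [_ + _] := FPr _ _ FX Xa; apply; eassumption.
  - by apply: subset_trans (CX0) _; exact: bigcup_sup.
have [C'1 _ _ _] := pC'.
have PC' : P C' by move=> _; split.
(* The maximal element is nonempty, since otherwise [C'] would lie strictly above it. *)
have [M0|M0] := pselect (M !=set0); last first.
  exfalso; apply: maxM PC'; split; last first.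
    by move=> /(_ _ (C'1 0)) M0'; apply: M0; exists (cst 0, 0).
  by move=> p Mp; exfalso; apply: M0; exists p.
have [pM dM CM] := PM M0; exists M; split => //.
  exact: subset_trans CC' CM.
move=> M' pM' dM' MM'; apply: contrapT => M'M; apply: (maxM M'); first by split.
by move=> _; split => //; exact: subset_trans CM MM'.
Qed.

(* A Hahn-Banach theorem: a maximal cone prices every bounded function and its
   opposite without spread. *)
Lemma price_cone_functional C : price_cone C ->
  exists L : (T -> R) -> R,
  [/\ forall c, L (cst c) = c,
      forall F G, is_bounded F -> is_bounded G ->
        L (fun z => F z + G z) = L F + L G,
      forall t F, 0 <= t -> is_bounded F ->
        L (fun z => t * F z) = t * L F &
      forall F G c, is_bounded F -> C (G, c) ->
        (forall z, F z <= G z) -> L F <= c].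
Proof.
move=> /maximal_price_cone[M [pM dM CM maxM]].
have [M1 MD MM M0] := pM.
(* The superhedging price of [F]. *)
pose L F := inf [set c | M (F, c)].
have MN F : is_bounded F -> M (fun z => - F z, - L F).
  move=> [K FK].
  (* Absence of arbitrage bounds the prices from below, so the infimum is not a default value. *)
  have lbF G c : M (G, c) -> (forall z, F z <= G z) -> - K <= c.
    move=> MG FG; rewrite -subr_ge0 opprK; apply: M0 (MD _ _ _ _ MG (M1 K)) _.
    move=> z; have := FK z; have := FG z; rewrite ler_norml /=; lra.
  (* By maximality, the extension that sells [F] at [L F] is already contained in [M]. *)
  have [M' [pM' dM' MM' M'F]] : exists C', [/\ price_cone C', downward C', M `<=` C' &
       C' (fun z => - F z, - L F)].
    apply: price_cone_add => // G b MG FG.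
    apply: ge_inf; first by exists (- K) => c /= /lbF; apply.
    exact: dM MG FG _.
  exact: maxM MM' _ M'F.
have Lle F c : is_bounded F -> M (F, c) -> L F <= c.
  move=> bF MF; have := MD _ _ _ _ MF (MN _ bF).
  by move=> /M0; rewrite subr_ge0; apply => z; rewrite subrr.
(* The infimum is attained: [MN] for [- F] gives [F] the price [- L (- F)], which is at most [L F]
   because a price of [F] and one of [- F] have a nonnegative sum. *)
have ML F : is_bounded F -> M (F, L F).
  move=> bF; have MNN := MN _ (is_boundedN bF).
  apply: (dM _ _ _ _ MNN); first by move=> z; rewrite opprK.
  rewrite lerNl; apply: lb_le_inf => [|d Md]; first by exists (- L F); exact: MN.
  have [K FK] := bF.
  rewrite lerNl; apply: lb_le_inf => [|c Mc].
    by exists K; apply: dM (M1 K) _ _ => // z; rewrite (le_trans (ler_norm _)).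
  rewrite -subr_ge0 opprK; apply: M0 (MD _ _ _ _ Mc Md) _ => z.
  by rewrite subrr.
have Lge F c : is_bounded F -> M (fun z => - F z, - c) -> c <= L F.
  move=> bF MF; have := MD _ _ _ _ MF (ML _ bF).
  by move=> /M0; rewrite addrC subr_ge0; apply => z; rewrite addrC subrr.
exists L; split.
- move=> c; have bc : is_bounded (cst c : T -> R) := is_bounded_cst c.
  by apply/le_anti/andP; split; [exact: Lle|exact: (Lge (cst c) _ bc (M1 (- c)))].
- move=> F G bF bG; apply/le_anti/andP; split.
    by apply: Lle; [exact: is_boundedD|apply: MD; exact: ML].
  apply: Lge; first exact: is_boundedD.
  by apply: dM (MD _ _ _ _ (MN _ bF) (MN _ bG)) _ _ => [z|]; rewrite opprD.
- move=> t F t0 bF; have btF := is_boundedM (is_bounded_cst t) bF.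
  apply/le_anti/andP; split.
    by apply: Lle => //; apply: MM => //; exact: ML.
  apply: Lge => //.
  by apply: dM (MM _ _ _ t0 (MN _ bF)) _ _ => [z|]; rewrite mulrN.
- move=> F G c bF /CM MG FG; apply: Lle => //.
  exact: dM MG FG _.
Qed.

End price_cone.

(** * Radon measures from prices *)

(** Otherwise the sets [A] for which [K] minus [A] satisfies [Q] form a proper filter containing
    [K]; a cluster point of it in [K] contradicts the local hypothesis. *)
Lemma compact_local_union (T : topologicalType) (Q : set (set T)) (K : set T) :
  compact K -> Q set0 ->
  (forall A B, A `<=` B -> Q B -> Q A) ->
  (forall A B, Q A -> Q B -> Q (A `|` B)) ->
  (forall z, K z -> exists2 A, nbhs z A & Q A) -> Q K.
Proof.
move=> cK Q0 QS QU Qloc; apply: contrapT => nQ.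
pose F := [set A | Q (K `\` A)].
have PF : ProperFilter F.
  split; first by rewrite /F /= setD0.
  split; first by rewrite /F /= setDT.
  - by move=> A B FA FB; rewrite /F /= setDIr; exact: QU.
  - by move=> A B AB; apply: QS; exact: setDS.
have [|z [Kz Fz]] := cK F PF; first by rewrite /F /= setDv.
have [A Az QA] := Qloc z Kz.
have [|x []] := Fz (~` A) A _ Az; last by [].
by rewrite /F /= setDE setCK; apply: QS QA; exact: subIsetr.
Qed.

(** [compact_local_union] reduces [C] to small neighbourhoods of its points, where the Hausdorff
    property applies; for a union of two sets the neighbourhoods of [z] are intersected. *)
Lemma compact_separation (T : topologicalType) (C : set T) (z : T) :
  hausdorff_space T -> compact C -> ~ C z ->
  exists2 A, nbhs z A & closure A `&` C = set0.
Proof.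
rewrite open_hausdorff => hT cC Cz.
have [|A B AB [B' zB' B'C]|A B [A' zA' A'C] [B' zB' B'C]|x Cx|A zA AC] :=
  @compact_local_union _ [set B | exists2 A, nbhs z A & closure A `&` B = set0]
    C cC; rewrite /=; last by exists A.
- by exists setT; [exact: filterT|rewrite setI0].
- by exists B' => //; rewrite -subset0 -B'C; exact: setIS.
- exists (A' `&` B'); first exact: filterI.
  rewrite -subset0 => y [clAB [Ay|By]].
    by rewrite -A'C; split => //; apply: closureS clAB; exact: subIsetl.
  by rewrite -B'C; split => //; apply: closureS clAB; exact: subIsetr.
- have [|[U V] /= [zU xV] [oU oV UV]] := hT z x.
    by apply: contra_notN Cz => /eqP ->.
  move: zU xV; rewrite !inE => zU xV.
  exists V; first by apply: open_nbhs_nbhs.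
  exists U; first by apply: open_nbhs_nbhs.
  rewrite -subset0 => y [clUy Vy].
  have [|w] := clUy V; first by apply: open_nbhs_nbhs.
  by rewrite (eqP UV).
Qed.

(** A point of [K] in [U n] has a neighbourhood whose closure meets [K] only inside [U n]; its trace
    on [K] gives a compact piece of [U n]. *)
Lemma compact_countable_decomposition (T : topologicalType) (K : set T)
    (U : nat -> set T) : hausdorff_space T -> compact K ->
  (forall n, open (U n)) -> K `<=` \bigcup_n U n ->
  exists (L : nat -> set T) (N : nat),
    [/\ forall n, compact (L n), forall n, L n `<=` U n &
        K `<=` \big[setU/set0]_(n < N) L n].
Proof.
move=> hT cK oU KU.
pose Q := [set A : set T | exists (L : nat -> set T) (N : nat),
    [/\ forall n, compact (L n), forall n, L n `<=` U n &
        K `&` A `<=` \big[setU/set0]_(n < N) L n]].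
suff : Q K by rewrite /Q /= setIid.
apply: compact_local_union => //.
- by exists (fun=> set0), 0; split => [n|n x|x []] //; exact: compact0.
- move=> A B AB [L [N [cL LU KL]]]; exists L, N; split => //.
  by apply: subset_trans KL; exact: setIS.
- move=> A B [L [N [cL LU KL]]] [L' [N' [cL' LU' KL']]].
  exists (fun n => L n `|` L' n), (maxn N N'); split => [n|n|].
  + exact: compactU.
  + by rewrite subUset.
  + move: KL KL'; rewrite -!bigcup_mkord => KL KL' x.
    rewrite -(bigcup_mkord _ (fun n => L n `|` L' n)) => -[Kx [Ax|Bx]].
      have [n /= nN Lnx] := KL x (conj Kx Ax); exists n => /=; last by left.
      by rewrite (leq_trans nN)// leq_maxl.
    have [n /= nN Lnx] := KL' x (conj Kx Bx); exists n => /=; last by right.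
    by rewrite (leq_trans nN)// leq_maxr.
- move=> z Kz; have [n _ Unz] := KU z Kz.
  have [||A zA AKU] := @compact_separation _ (K `\` U n) z hT.
    by rewrite setDE; apply: compact_closedI => //; exact: open_closedC.
    by move=> [].
  (* All of the piece sits at index [n]; the bound [n.+1] makes the finite union reach it. *)
  exists A => //; exists (fun m => if m == n then K `&` closure A else set0), n.+1.
  split => [m|m|].
  + case: ifPn => _; last exact: compact0.
    by apply: compact_closedI => //; exact: closed_closure.
  + case: ifPn => [/eqP -> x [Kx Ax]|_ x //].
    by apply: contrapT => Ux; have : set0 x by rewrite -AKU.
  + rewrite -(bigcup_mkord _ (fun m => if m == n then K `&` closure A else set0)).
    move=> x [Kx Ax]; exists n => //=.
    by rewrite eqxx; split => //; exact: subset_closure.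
Qed.

(* Halmos' construction of a measure from a content on compact sets. *)
Section content_to_measure.
Context {R : realType} (Z : ptopologicalType) (m0 : set Z -> R).
Context (hZ : hausdorff_space Z) (m0_set0 : m0 set0 = 0)
  (m0_mono : forall A B, A `<=` B -> m0 A <= m0 B)
  (m0U : forall A B, m0 (A `|` B) <= m0 A + m0 B)
  (m0UD : forall A B, A `&` B = set0 -> m0 A + m0 B <= m0 (A `|` B))
  (m0T : m0 setT = 1)
  (m0_tight : forall e, 0 < e -> exists2 K, compact K & m0 (~` K) <= e).
Local Open Scope ereal_scope.

Let inner (U : set Z) : \bar R :=
  ereal_sup [set (m0 K)%:E | K in [set K | compact K /\ K `<=` U]].

Let outer (A : set Z) : \bar R :=
  ereal_inf [set inner U | U in [set U | open U /\ A `<=` U]].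

Let m0_le_inner K U : compact K -> K `<=` U -> (m0 K)%:E <= inner U.
Proof. by move=> cK KU; apply: ereal_sup_ubound; exists K. Qed.

Let inner_ge0 U : 0 <= inner U.
Proof.
apply: (@le_trans _ _ (m0 set0)%:E); first by rewrite m0_set0.
by apply: m0_le_inner; [exact: compact0|exact: sub0set].
Qed.

Let inner_le_m0 U : inner U <= (m0 U)%:E.
Proof.
by apply: ge_ereal_sup => _ [K [_ KU] <-]; rewrite lee_fin m0_mono.
Qed.

Let outer_ge0 A : 0 <= outer A.
Proof. by apply: le_ereal_inf_tmp => _ [U _ <-]. Qed.

Let outer_le_inner A U : open U -> A `<=` U -> outer A <= inner U.
Proof. by move=> oU AU; apply: ereal_inf_lbound; exists U. Qed.

Let outer_mono A B : A `<=` B -> outer A <= outer B.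
Proof.
move=> AB; apply: le_ereal_inf_tmp => _ [U [oU BU] <-].
by apply: outer_le_inner => //; exact: subset_trans BU.
Qed.

Let outer_le1 A : outer A <= 1.
Proof.
apply: (le_trans (outer_le_inner openT (@subsetT _ A))).
by rewrite (le_trans (inner_le_m0 _))// m0T.
Qed.

Let outer_fin A : outer A \is a fin_num.
Proof.
by rewrite ge0_fin_numE ?outer_ge0// (le_lt_trans (outer_le1 A)) ?ltry.
Qed.

Let outer_open U : open U -> outer U = inner U.
Proof.
move=> oU; apply/le_anti/andP; split; first exact: outer_le_inner.
apply: le_ereal_inf_tmp => _ [V [oV UV] <-].
apply: ge_ereal_sup => _ [K [cK KU] <-].
by apply: m0_le_inner => //; exact: subset_trans UV.
Qed.

(** A compact subset of the union splits into finitely many compact pieces, each inside one [U n],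
    so finite subadditivity of [m0] suffices. *)
Let inner_sigma_subadditive (U : nat -> set Z) : (forall n, open (U n)) ->
  inner (\bigcup_n U n) <= \sum_(n <oo) inner (U n).
Proof.
move=> oU; apply: ge_ereal_sup => _ [K [cK KU] <-].
have [L [N [cL LU KL]]] := compact_countable_decomposition hZ cK oU KU.
have m0L : (m0 K <= \sum_(n < N) m0 (L n))%R.
  apply: (le_trans (m0_mono KL)); elim: (N) => [|M IH].
    by rewrite !big_ord0 m0_set0.
  by rewrite !big_ord_recr /= (le_trans (m0U _ _))// lerD2r.
apply: (@le_trans _ _ (\sum_(n < N) inner (U n))).
  apply: (@le_trans _ _ (\sum_(n < N) m0 (L n))%:E); first by rewrite lee_fin.
  by rewrite -sumEFin; apply: lee_sum => n _; exact: m0_le_inner.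
rewrite -(big_mkord xpredT (fun n => inner (U n))).
by apply: nneseries_lim_ge => n _ _; exact: inner_ge0.
Qed.

Let outer_set0 : outer set0 = 0.
Proof.
apply/le_anti/andP; split; last exact: outer_ge0.
apply: (le_trans (outer_le_inner open0 (@subset_refl _ _))).
by rewrite (le_trans (inner_le_m0 _))// m0_set0.
Qed.

Let outer_subadditive : sigma_subadditive outer.
Proof.
move=> F; apply/lee_addgt0Pr => e e0.
(* Nearly optimal open sets around the [F n], with errors adding up to at most [e]. *)
have /choice[U oU] n : exists V, [/\ open V, F n `<=` V &
    inner V <= outer (F n) + (e / (2 ^ n.+1)%:R)%:E].
  have dn : (0 < e / (2 ^ n.+1)%:R :> R)%R.
    by rewrite divr_gt0// ltr0n expn_gt0.
  have [_ [V [oV FV] <-] Vlt] := lb_ereal_inf_adherent dn (outer_fin (F n)).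
  by exists V; split => //; exact: ltW.
apply: (@le_trans _ _ (\sum_(n <oo) (outer (F n) + (e / (2 ^ n.+1)%:R)%:E))).
  apply: (@le_trans _ _ (inner (\bigcup_n U n))).
    apply: outer_le_inner; first by apply: bigcup_open => n _; have [] := oU n.
    by apply: subset_bigcup => n _; have [] := oU n.
  apply: (le_trans (inner_sigma_subadditive _)); first by move=> n; have [] := oU n.
  by apply: lee_nneseries => [n _|n _] //; have [] := oU n.
exact: epsilon_trick (ltW e0).
Qed.

HB.instance Definition _ := isOuterMeasure.Build R Z outer
  outer_set0 outer_ge0 outer_mono outer_subadditive.

(** Take a compact [K] in the part of [V] inside [U], then a compact [K'] in [V] minus [K]. They are
    disjoint compact subsets of [V], so their contents add up to at most [inner V]. *)
Let outer_open_caratheodory U : open U -> outer.-caratheodory U.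
Proof.
move=> oU; apply: le_caratheodory_measurable => X.
apply: le_ereal_inf_tmp => _ [V [oV XV] <-].
rewrite -leeBrDr//.
apply: (le_trans (outer_le_inner (openI oV oU) (setSI XV))).
apply: ge_ereal_sup => _ [K [cK KVU] <-].
rewrite leeBrDr// addeC -leeBrDr//.
have oVK : open (V `\` K).
  by rewrite setDE; apply: openI => //; apply: closed_openC; exact: compact_closed.
apply: (@le_trans _ _ (inner (V `\` K))).
  apply: outer_le_inner => // x [Xx Ux]; split; first exact: XV.
  by move=> /KVU[].
apply: ge_ereal_sup => _ [K' [cK' K'VK] <-].
rewrite leeBrDr// -EFinD (@le_trans _ _ (m0 (K' `|` K))%:E)//.
  rewrite lee_fin m0UD//; rewrite -subset0 => x [/K'VK[_ ?]] //.
apply: m0_le_inner; first exact: compactU.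
by rewrite subUset; split => x; [move=> /K'VK[]|move=> /KVU[]].
Qed.

Let borel_caratheodory (A : set (borel Z)) : measurable A ->
  outer.-caratheodory A.
Proof.
suff : <<s @open Z >> `<=` outer.-cara.-measurable by apply.
apply: smallest_sub; first exact: sigma_algebra_measurable.
by move=> U; exact: outer_open_caratheodory.
Qed.

(** The same set function, typed on [borel Z] so that the measure structure is attached to the Borel
    sets instead of the Caratheodory ones. *)
Let gamma : set (borel Z) -> \bar R := outer.

Let gamma_additive : semi_sigma_additive gamma.
Proof.
move=> F mF tF mUF.
apply: (@caratheodory_measure_sigma_additive R Z outer F) => //.
  by move=> n; exact: borel_caratheodory.
exact: borel_caratheodory.
Qed.

HB.instance Definition _ := isMeasure.Build _ (borel Z) R gamma
  outer_set0 outer_ge0 gamma_additive.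

(** Tightness prevents a loss of mass in the passage to compact subsets. *)
Let gammaT : gamma setT = 1.
Proof.
apply/le_anti/andP; split; first exact: outer_le1.
rewrite /gamma outer_open; last exact: openT.
apply/lee_subgt0Pr => e e0; have [K cK Ke] := m0_tight e0.
apply: (le_trans _ (m0_le_inner cK (@subsetT _ _))).
by rewrite lee_fin lerBlDr -m0T -(setUv K) (le_trans (m0U _ _))// lerD2l.
Qed.

HB.instance Definition _ := Measure_isProbability.Build _ _ _ gamma gammaT.

(** Inner regularity comes from complements: with an open [V] around the complement of [B] of small
    excess and a compact [K] of small complement, [K] minus [V] is a compact subset of [B] that
    misses little of it. *)
Lemma radon_of_content : exists gamma : probability (borel Z) R,
  radon gamma /\ forall U : set Z, open U -> gamma U <= (m0 U)%:E.
Proof.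
exists gamma; split; last by move=> U oU; rewrite /= /gamma outer_open.
have mopen (U : set Z) : open U -> measurable (U : set (borel Z)).
  by move=> oU; exact: sub_sigma_algebra.
have mcompact (K : set Z) : compact K -> measurable (K : set (borel Z)).
  move=> cK; rewrite -(setCK K); apply: measurableC; apply: mopen.
  by apply: closed_openC; exact: compact_closed.
move=> B mB e e0; have e2 : (0 < e / 2)%R by rewrite divr_gt0.
have [_ [V [oV BV] <-] Vlt] := lb_ereal_inf_adherent e2 (outer_fin (~` B)).
have e4 : (0 < e / 2 / 2)%R by rewrite divr_gt0.
have [K cK Ke] := m0_tight e4.
exists (K `&` ~` V); split.
- by apply: compact_closedI => //; exact: open_closedC.
- by move=> x [_ Vx]; apply: contrapT => /BV.
- have mV := mopen _ oV.
  have mK := mcompact _ cK.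
  have gV : gamma V = gamma (V `\` ~` B) + gamma (~` B).
    rewrite (@measureDI _ _ _ gamma V (~` B)) ?(setIidr BV)//.
    exact: measurableC.
  have gVB : gamma (V `\` ~` B) < (e / 2)%:E.
    rewrite -(@lteD2rE _ (gamma (~` B))) ?outer_fin// -gV addeC.
    by rewrite /gamma outer_open.
  apply: (@le_lt_trans _ _ (gamma (V `\` ~` B `|` ~` K))).
    apply: outer_mono => x [Bx KVx]; rewrite setDE setCK.
    have [Kx|] := pselect (K x); last by right.
    by left; split => //; apply: contrapT => Vx; exact: KVx.
  apply: (le_lt_trans (outer_measureU2 outer _ _)).
  rewrite [e](splitr e) EFinD; apply: lte_leD => //.
  apply: (@le_trans _ _ (e / 2 / 2)%:E); last first.
    by rewrite lee_fin ler_pdivrMr// ler_peMr ?ltW// ltr1n.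
  have oK : open (~` K) by apply: closed_openC; exact: compact_closed.
  apply: (le_trans (outer_le_inner oK (@subset_refl _ _))).
  by rewrite (le_trans (inner_le_m0 _)).
Qed.

End content_to_measure.

(** * Expectations of bounded measurable functions *)

Section bounded_measurable.
Context d (T : measurableType d) (R : realType) (mu : probability T R).
Implicit Types f g : T -> R.

Definition bounded_measurable f := measurable_fun setT f /\ is_bounded f.

Lemma bounded_measurable_cst (c : R) : bounded_measurable (cst c).
Proof. by split; [exact: measurable_cst|exact: is_bounded_cst]. Qed.

Lemma bounded_measurableD f g : bounded_measurable f -> bounded_measurable g ->
  bounded_measurable (fun x => f x + g x).
Proof.
move=> [mf bf] [mg bg]; split; [exact: measurable_funD|exact: is_boundedD].
Qed.

Lemma bounded_measurableN f : bounded_measurable f ->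
  bounded_measurable (fun x => - f x).
Proof.
by move=> [mf bf]; split; [exact: measurable_funN|exact: is_boundedN].
Qed.

Lemma bounded_measurableM (t : R) f : bounded_measurable f ->
  bounded_measurable (fun x => t * f x).
Proof.
move=> [mf bf]; split; first by apply: measurable_funM.
by apply: is_boundedM => //; exact: is_bounded_cst.
Qed.

Lemma bounded_measurable_indic (A : set T) : measurable A ->
  bounded_measurable (\1_A : T -> R).
Proof.
by move=> mA; split; [exact: measurable_indic|exact: is_bounded_indic].
Qed.

Lemma bounded_measurable_sum (I : Type) (s : seq I) (F : I -> T -> R) :
  (forall i, bounded_measurable (F i)) ->
  bounded_measurable (fun x => \sum_(i <- s) F i x).
Proof.
move=> bF; split; last by apply: is_bounded_sum => i; have [] := bF i.
elim: s => [|i s IH].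
  by under eq_fun do rewrite big_nil; exact: measurable_cst.
by under eq_fun do rewrite big_cons; apply: measurable_funD; first have [] := bF i.
Qed.

Lemma bounded_measurable_integrable f : bounded_measurable f ->
  mu.-integrable setT (EFin \o f).
Proof.
move=> [mf [M fM]]; apply: measurable_bounded_integrable => //.
  by rewrite (le_lt_trans (probability_le1 mu _))// ltry.
by exists M; split; rewrite ?num_real// => r Mr x _ /=; rewrite (le_trans (fM x))// ltW.
Qed.

Lemma EFin_expectation f : bounded_measurable f ->
  (\int[mu]_x f x)%:E = (\int[mu]_x (f x)%:E)%E.
Proof.
by move=> bf; rewrite fineK//; apply: integrable_fin_num => //;
  exact: bounded_measurable_integrable.
Qed.

Lemma expectation_cst (c : R) : \int[mu]_x c = c.
Proof.
rewrite Rintegral_cst// [X in fine X](_ : _ = 1%E) ?mulr1//.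
exact: probability_setT.
Qed.

Lemma expectationD f g : bounded_measurable f -> bounded_measurable g ->
  \int[mu]_x (f x + g x) = \int[mu]_x f x + \int[mu]_x g x.
Proof. by move=> bf bg; rewrite RintegralD//; exact: bounded_measurable_integrable. Qed.

Lemma expectationM (t : R) f : bounded_measurable f ->
  \int[mu]_x (t * f x) = t * \int[mu]_x f x.
Proof. by move=> bf; rewrite RintegralZl//; exact: bounded_measurable_integrable. Qed.

Lemma expectationN f : bounded_measurable f ->
  \int[mu]_x (- f x) = - \int[mu]_x f x.
Proof.
by move=> bf; rewrite -mulN1r -expectationM//; under eq_Rintegral do rewrite -mulN1r.
Qed.

Lemma expectation_sum (I : Type) (s : seq I) (F : I -> T -> R) :
  (forall i, bounded_measurable (F i)) ->
  \int[mu]_x (\sum_(i <- s) F i x) = \sum_(i <- s) \int[mu]_x F i x.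
Proof.
move=> bF; elim: s => [|i s IH].
  by under eq_Rintegral do rewrite big_nil; rewrite expectation_cst big_nil.
under eq_Rintegral do rewrite big_cons.
by rewrite expectationD// ?IH ?big_cons//; exact: bounded_measurable_sum.
Qed.

Lemma le_expectation f g : bounded_measurable f -> bounded_measurable g ->
  (forall x, f x <= g x) -> \int[mu]_x f x <= \int[mu]_x g x.
Proof. by move=> bf bg fg; apply: le_Rintegral => //; exact: bounded_measurable_integrable. Qed.

Lemma expectation_indic (A : set T) : measurable A ->
  \int[mu]_x \1_A x = fine (mu A).
Proof. by move=> mA; rewrite /Rintegral integral_indic// setIT. Qed.

End bounded_measurable.

(** The law of [p] is given by its values instead of as a pushforward, which is the form in which
    marginals are known. *)
Lemma expectation_pushforward d d' (T : measurableType d) (T' : measurableType d')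
    (R : realType) (mu : probability T R) (nu : probability T' R) (p : T -> T')
    (f : T' -> R) : measurable_fun setT p ->
  (forall A, measurable A -> mu (p @^-1` A) = nu A) -> bounded_measurable f ->
  \int[mu]_x f (p x) = \int[nu]_y f y.
Proof.
move=> mp mupnu bf; congr fine.
transitivity (\int[pushforward mu p]_y (f y)%:E)%E; last first.
  by apply: eq_measure_integral => A mA _; exact: mupnu.
rewrite integral_pushforward//.
  by apply/measurable_EFinP; have [] := bf.
rewrite preimage_setT.
have bfp : bounded_measurable (f \o p).
  have [mf [M fM]] := bf; split; first exact: measurableT_comp.
  by exists M => x; exact: fM.
exact: (bounded_measurable_integrable mu bfp).
Qed.

(** The counterpart for nonnegative functions, whose integrals may be infinite. *)
Lemma ge0_integral_image d d' (T : measurableType d) (T' : measurableType d')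
    (R : realType) (mu : probability T R) (nu : probability T' R) (p : T -> T')
    (f : T' -> \bar R) : measurable_fun setT p ->
  (forall A, measurable A -> mu (p @^-1` A) = nu A) ->
  measurable_fun setT f -> (forall y, (0 <= f y)%E) ->
  (\int[mu]_x f (p x) = \int[nu]_y f y)%E.
Proof.
move=> mp mupnu mf f0.
transitivity (\int[pushforward mu p]_y f y)%E; last first.
  by apply: eq_measure_integral => A mA _; exact: mupnu.
by rewrite ge0_integral_pushforward// preimage_setT.
Qed.

(** * Lower semicontinuous functions and staircase approximation *)

Section semicontinuous.
Context {R : realType} {T : topologicalType}.

Definition lsc (f : T -> R) := forall t, open [set x | t < f x].

Lemma continuous_lsc (f : T -> R) : continuous f -> lsc f.
Proof.
move=> cf t; rewrite (_ : [set _ | _] = f @^-1` [set y | t < y])//.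
by apply: open_comp => //; exact: open_gt.
Qed.

Lemma open_lsc_indic (U : set T) : open U -> lsc (\1_U).
Proof.
move=> oU t; have [t1|t1] := leP 1 t.
  rewrite (_ : [set _ | _] = set0); first exact: open0.
  rewrite -subset0 => x /=; rewrite indicE ltNge.
  by rewrite (le_trans _ t1)// lern1 leq_b1.
have [t0|t0] := leP 0 t.
  rewrite (_ : [set _ | _] = U)//; apply/seteqP; split => x /=; rewrite indicE.
    by apply: contraPP => Ux; rewrite memNset//; apply/negP; rewrite -leNgt.
  by move=> Ux; rewrite mem_set.
rewrite (_ : [set _ | _] = setT); first exact: openT.
by apply/seteqP; split => // x _ /=; rewrite indicE (lt_le_trans t0).
Qed.

Lemma lsc_max (f g : T -> R) : lsc f -> lsc g ->
  lsc (fun x => Num.max (f x) (g x)).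
Proof.
move=> lf lg t.
rewrite (_ : [set _ | _] = [set x | t < f x] `|` [set x | t < g x]).
  exact: openU.
by apply/seteqP; split => x /=; rewrite lt_max => /orP.
Qed.

Lemma lsc_min (f g : T -> R) : lsc f -> lsc g ->
  lsc (fun x => Num.min (f x) (g x)).
Proof.
move=> lf lg t.
rewrite (_ : [set _ | _] = [set x | t < f x] `&` [set x | t < g x]).
  exact: openI.
by apply/seteqP; split => x /=; rewrite lt_min => /andP.
Qed.

End semicontinuous.

Lemma lsc_measurable (R : realType) (Z : ptopologicalType) (f : Z -> R) :
  lsc f -> measurable_fun setT (f : borel Z -> R).
Proof.
move=> lf _; apply: (measurability _ (RGenOInfty.measurableE R)) => //.
move=> _ [_ [t ->] <-]; rewrite setTI; apply: sub_sigma_algebra.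
rewrite (_ : _ @^-1` _ = [set x | t < f x])//.
by apply/seteqP; split => x /=; rewrite in_itv /= andbT.
Qed.

(** The sum is [e] times the number of levels among [e], ..., [N e] lying below [x]: a layer-cake
    approximation from below. *)
Lemma staircase (R : realType) (e x : R) (N : nat) :
  0 <= e -> 0 <= x -> x <= N%:R * e ->
  let s := \sum_(k < N) e * (k.+1%:R * e < x)%R%:R in s <= x /\ x <= s + e.
Proof.
move=> e0 x0 xN s.
(* The induction runs without the bound [x <= N e], so it has to allow the saturated case
   [s = N e]. *)
suff [xs [sN sx]] : (x <= s + e \/ s = N%:R * e) /\ s <= N%:R * e /\ s <= x.
  by split => //; case: xs => // ->; rewrite (le_trans xN)// lerDl.
rewrite {}/s; elim: N {xN} => [|N [xs [sN sx]]].
  by rewrite big_ord0 mul0r; split; [right|split].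
rewrite big_ord_recr /=; set s := \sum_(i < N) _ in xs sN sx *.
have [lt|ge] := ltP (N.+1%:R * e) x; rewrite ?mulr1 ?mulr0 -natr1 mulrDl mul1r.
  split; first by case: xs => [xs|->]; [left; lra|right].
  split; first by rewrite lerD2r.
  by rewrite -natr1 mulrDl mul1r in lt; rewrite (le_trans _ (ltW lt))// lerD2r.
rewrite -natr1 mulrDl mul1r in ge.
rewrite addr0; split; last by split => //; rewrite (le_trans sN)// lerDl.
by left; case: xs => [//|->].
Qed.

(** * From an arbitrage-free tight cone to a Radon probability *)

Section radon_of_price_cone.
Context {R : realType} (Z : ptopologicalType) (C : set ((Z -> R) * R)).
Context (hZ : hausdorff_space Z) (pC : price_cone C).
Context (tC : forall e, 0 < e -> exists K, compact K /\
  exists G c, [/\ C (G, c), forall z, \1_(~` K) z <= G z & c <= e]).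

(** On indicators, [L] is a tight content, and the resulting measure is at most [L] on open sets. A
    nonnegative lower semicontinuous function is, up to [e], a positive combination of indicators of
    its open superlevel sets, so its integral is at most its price. *)
Lemma radon_of_price_cone : exists2 gamma : probability (borel Z) R,
  radon gamma & forall F G c, lsc F -> is_bounded F -> C (G, c) ->
    (forall z, F z <= G z) -> \int[gamma]_z F z <= c.
Proof.
have [L [L1 LD LM LC]] := price_cone_functional pC.
have [C1 _ _ _] := pC.
(* [F - G] is dominated by the payoff [0], which has price [0]. *)
have Lmono F G : is_bounded F -> is_bounded G -> (forall z, F z <= G z) ->
    L F <= L G.
  move=> bF bG FG.
  have bGF := is_boundedD bF (is_boundedN bG).
  have := LD _ _ bG bGF; rewrite (_ : (fun z => _) = F); last first.
    by apply/funext => z; rewrite addrC subrK.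
  move=> ->; rewrite gerDl; apply: LC (C1 0) _ => // z.
  by rewrite subr_le0.
have bI (A : set Z) : is_bounded (\1_A : Z -> R) by exact: is_bounded_indic.
have Z1 (A B : set Z) : A `<=` B -> forall z, (\1_A z : R) <= \1_B z.
  move=> AB z; rewrite !indicE ler_nat.
  case: (asboolP (A z)) => [Az|Az]; last by rewrite (memNset Az).
  by rewrite !mem_set//; exact: AB.
pose m0 (A : set Z) := L \1_A.
have [gamma [rg gU]] : exists gamma : probability (borel Z) R,
    radon gamma /\ forall U : set Z, open U -> (gamma U <= (m0 U)%:E)%E.
  apply: radon_of_content => //; rewrite /m0.
  - by rewrite indic0 L1.
  - by move=> A B AB; apply: Lmono => // z; exact: Z1.
  - move=> A B; rewrite -LD//; apply: Lmono => //; first exact: is_boundedD.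
    move=> z; rewrite !indicE -natrD ler_nat in_setU.
    by case: (z \in A); case: (z \in B).
  - move=> A B AB; rewrite -LD//; apply: Lmono => //; first exact: is_boundedD.
    move=> z; rewrite !indicE -natrD ler_nat in_setU.
    have := in_setI z A B; rewrite AB in_set0.
    by case: (z \in A); case: (z \in B).
  - by rewrite indicT L1.
  - move=> e e0; have [K [cK [G [c [CG GK ce]]]]] := tC e0.
    by exists K => //; apply: le_trans ce; apply: LC CG _.
have mlsc F : lsc F -> is_bounded F ->
    bounded_measurable (F : borel Z -> R).
  by move=> lF bF; split => //; exact: lsc_measurable.
have EL F : lsc F -> is_bounded F -> (forall z, 0 <= F z) ->
    \int[gamma]_z F z <= L F.
  move=> lF bF F0; apply/ler_addgt0Pr => e e0.
  have [M FM] := bF.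
  (* Enough steps of height [e] to exceed the bound [M] of [F]. *)
  pose N := (Num.truncn (M / e)).+1.
  have FN z : F z <= N%:R * e.
    rewrite -ler_pdivrMr//; apply: ltW; apply: le_lt_trans (truncnS_gt _).
    by rewrite ler_pM2r ?invr_gt0// (le_trans (ler_norm _)).
  pose U (k : 'I_N) := [set z | k.+1%:R * e < F z].
  have UE (k : 'I_N) z : (k.+1%:R * e < F z)%R%:R = \1_(U k) z :> R.
    rewrite indicE; congr (nat_of_bool _)%:R.
    by apply/idP/idP => [?|/set_mem//]; exact: mem_set.
  pose S z := \sum_(k < N) e * \1_(U k) z.
  have SF z : S z <= F z /\ F z <= S z + e.
    have := staircase (ltW e0) (F0 z) (FN z); rewrite /S.
    by under eq_bigr do rewrite UE.
  have bS (s : seq 'I_N) : is_bounded (fun z => \sum_(k <- s) e * \1_(U k) z).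
    apply: is_bounded_sum => k; apply: is_boundedM => //.
    exact: is_bounded_cst.
  have mU k : measurable (U k : set (borel Z)).
    by apply: sub_sigma_algebra; exact: lF.
  have bmS (s : seq 'I_N) :
      bounded_measurable ((fun z => \sum_(k <- s) e * \1_(U k) z) : borel Z -> R).
    apply: bounded_measurable_sum => k; apply: bounded_measurableM.
    exact: bounded_measurable_indic.
  have ES (s : seq 'I_N) : \int[gamma]_z (\sum_(k <- s) e * \1_(U k) z) <=
      L (fun z => \sum_(k <- s) e * \1_(U k) z).
    elim: s => [|k s IH].
      rewrite (_ : (fun z => _) = cst 0) ?L1 ?expectation_cst//.
      by apply/funext => z; rewrite big_nil.
    rewrite (_ : (fun z => _) = fun z => e * \1_(U k) z +
        \sum_(i <- s) e * \1_(U i) z); last by apply/funext => z; rewrite big_cons.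
    have bk : bounded_measurable ((fun z => e * \1_(U k) z) : borel Z -> R).
      by apply: bounded_measurableM; exact: bounded_measurable_indic.
    rewrite expectationD// LD//; last exact: bk.2.
    apply: lerD => //; rewrite expectationM; last exact: bounded_measurable_indic.
    rewrite LM//; last exact: ltW.
    rewrite ler_pM2l// expectation_indic// -lee_fin fineK; first exact/gU/lF.
    by rewrite fin_num_measure.
  apply: (@le_trans _ _ (\int[gamma]_z (S z + e))).
    apply: le_expectation; [exact: mlsc| |by move=> z; have [] := SF z].
    by apply: bounded_measurableD; [exact: bmS|exact: bounded_measurable_cst].
  rewrite expectationD; [|exact: bmS|exact: bounded_measurable_cst].
  rewrite expectation_cst lerD2r (le_trans (ES _))//.
  by apply: Lmono => // z; have [] := SF z.
exists gamma => // F G c lF bF CG FG; apply: le_trans (LC _ _ _ bF CG FG).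
have [M FM] := bF.
(* Adding [M] makes the function nonnegative, and both the integral and [L] are exact on
   constants. *)
have bM : is_bounded (fun z => F z + M) by apply: is_boundedD; [|exact: is_bounded_cst].
have := EL (fun z => F z + M) _ bM.
rewrite LD//; last exact: is_bounded_cst.
rewrite expectationD; [|exact: mlsc|exact: bounded_measurable_cst].
rewrite expectation_cst L1 lerD2r; apply.
- move=> t; rewrite (_ : [set _ | _] = [set x | t - M < F x])//.
  by apply/seteqP; split => x /=; rewrite ltrBlDr.
- by move=> z; have := FM z; rewrite ler_norml; lra.
Qed.

End radon_of_price_cone.

(** * Comparison and images of Radon measures *)

Section radon_measures.
Context {R : realType}.
Implicit Types X Y Z : ptopologicalType.

Lemma open_borel X (U : set X) : open U -> measurable (U : set (borel X)).
Proof. by move=> oU; exact: sub_sigma_algebra. Qed.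

Lemma compact_borel X (K : set X) : hausdorff_space X -> compact K ->
  measurable (K : set (borel X)).
Proof.
move=> hX cK; rewrite -(setCK K); apply: measurableC; apply: open_borel.
by apply: closed_openC; exact: compact_closed.
Qed.

Lemma continuous_borel_measurable X Y (p : X -> Y) : continuous p ->
  measurable_fun setT (p : borel X -> borel Y).
Proof.
move=> cp; apply: (@measurability _ _ (borel X) (borel Y) setT p (@open Y)) => //.
move=> _ [U oU <-]; rewrite setTI; apply: open_borel.
by apply: open_comp => // x _; exact: cp.
Qed.

(** Applied to the complement of a compact [K], the inequality reverses to [nu K <= mu K]; inner
    regularity of [nu] then gives equality on open sets, which generate the Borel sets and are
    stable under intersection. This turns one-sided price bounds into exact marginals. *)
Lemma radon_eq X (mu nu : probability (borel X) R) : hausdorff_space X ->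
  radon mu -> radon nu ->
  (forall U : set X, open U -> (mu U <= nu U)%E) ->
  forall A, measurable A -> mu A = nu A.
Proof.
move=> hX rmu rnu munu A mA.
apply: (@measure_unique _ R (borel X) (@open X) (fun=> setT) _ _ _ _ mu nu) => //.
- by move=> {mA}A B; exact: openI.
- by move=> _; exact: openT.
- by apply/seteqP; split => // x _; exists 0.
- move=> U oU; apply/le_anti/andP; split; first exact: munu.
  have mU := open_borel oU.
  apply/lee_addgt0Pr => e e0; have [K [cK KU nuK]] := rnu _ mU _ e0.
  have mK := compact_borel hX cK.
  have := @measureDI _ _ _ nu U K mU mK; rewrite (setIidr KU) => ->.
  rewrite addeC; apply: leeD; last exact: ltW.
  apply: (@le_trans _ _ (mu K)); last by apply: le_measure; rewrite ?inE.
  have oK : open (~` K) by apply: closed_openC; exact: compact_closed.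
  have := munu _ oK; rewrite !probability_setC//.
  rewrite -(fineK (fin_num_measure mu _ mK)) -(fineK (fin_num_measure nu _ mK)).
  rewrite -!EFinB lee_fin lerD2l lerN2 => munuK.
  by rewrite -[leLHS](fineK (fin_num_measure nu _ mK)) lee_fin.
- by move=> _; rewrite (le_lt_trans (probability_le1 _ _)) ?ltry.
Qed.

(** A compact subset of the preimage of [B] that misses little mass has a compact image in [B] that
    misses no more. *)
Lemma radon_image X Y (p : X -> Y) (mu : probability (borel X) R) :
  hausdorff_space X -> hausdorff_space Y -> continuous p -> radon mu ->
  exists2 nu : probability (borel Y) R, radon nu &
    forall A : set (borel Y), measurable A -> mu (p @^-1` A) = nu A.
Proof.
move=> hX hY cp rmu; have mp := continuous_borel_measurable cp.
pose p' : {mfun borel X >-> borel Y} := mfun_Sub (mem_set mp).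
exists (distribution mu p') => // B mB e e0.
have mpB : measurable (p @^-1` B : set (borel X)).
  by rewrite -[X in measurable X]setTI; exact: (mp _ _ mB).
have [K [cK KB muK]] := rmu _ mpB _ e0.
have cpK : compact (p @` K).
  by apply: continuous_compact => //; exact: continuous_subspaceT.
exists (p @` K); split => //; first by move=> _ [x Kx <-]; exact: KB.
suff : (mu (p @^-1` (B `\` p @` K)) <= mu (p @^-1` B `\` K))%E.
  by move=> /le_lt_trans; exact.
apply: le_measure; rewrite ?inE.
- rewrite -[X in measurable X]setTI; apply: (mp measurableT).
  by apply: measurableD => //; exact: compact_borel.
- by apply: measurableD => //; exact: compact_borel.
- by move=> x [Bx pKx]; split => // Kx; apply: pKx; exists x.
Qed.

End radon_measures.

(** * Suprema of uniformly bounded families *)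

Section bounded_sup.
Context {R : realType} {J : pointedType}.
Implicit Types f : J -> R.

Lemma le_sup_range f (M : R) (j : J) : (forall j, f j <= M) -> f j <= sup (range f).
Proof.
by move=> fM; apply: ub_le_sup; [exists M => _ [k _ <-]|exists j].
Qed.

Lemma sup_range_le f (M : R) : (forall j, f j <= M) -> sup (range f) <= M.
Proof.
by move=> fM; apply: ge_sup => [|_ [k _ <-]//]; exists (f point), point.
Qed.

Lemma sup_range_bounded f (M : R) : (forall j, `|f j| <= M) ->
  `|sup (range f)| <= M.
Proof.
move=> fM; rewrite ler_norml; apply/andP; split.
  apply: (@le_trans _ _ (f point)).
    by have := fM point; rewrite ler_norml => /andP[].
  by apply: (@le_sup_range _ M) => j; rewrite (le_trans (ler_norm _)).
by apply: sup_range_le => j; rewrite (le_trans (ler_norm _)).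
Qed.

Lemma lsc_sup (T : topologicalType) (f : J -> T -> R) (M : R) :
  (forall j, lsc (f j)) -> (forall j x, f j x <= M) ->
  lsc (fun x => sup (range (f ^~ x))).
Proof.
move=> lf fM t.
rewrite (_ : [set _ | _] = \bigcup_j [set x | t < f j x]).
  by apply: bigcup_open => j _; exact: lf.
apply/seteqP; split => x /=.
  move=> /sup_gt[|_ [j _ <-] tf]; last by exists j.
  by exists (f point x), point.
by move=> [j _ /= tf]; apply: lt_le_trans tf (le_sup_range _ _) => k; exact: fM.
Qed.

End bounded_sup.

Lemma hausdorff_prod (X Y : topologicalType) : hausdorff_space X ->
  hausdorff_space Y -> hausdorff_space (X * Y)%type.
Proof.
move=> hX hY [x y] [x' y'] clp; congr pair.
- apply: hX => A B xA yB; have [||[u v] [/= Au Bu]] := clp (fst @^-1` A) (fst @^-1` B).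
  + exact: (cvg_fst xA).
  + exact: (cvg_fst yB).
  + by exists u.
- apply: hY => A B xA yB; have [||[u v] [/= Au Bu]] := clp (snd @^-1` A) (snd @^-1` B).
  + exact: (cvg_snd xA).
  + exact: (cvg_snd yB).
  + by exists v.
Qed.

(** * Gluing and the transfer of costs *)

Lemma continuous_pair (Z S T : topologicalType) (f : Z -> S) (g : Z -> T) :
  continuous f -> continuous g -> continuous (fun z => (f z, g z)).
Proof. by move=> cf cg z; apply: cvg_pair; [exact: cf|exact: cg]. Qed.

Lemma continuous_fst (S T : topologicalType) : continuous (@fst S T).
Proof. by move=> z; exact: cvg_fst. Qed.

Lemma continuous_snd (S T : topologicalType) : continuous (@snd S T).
Proof. by move=> z; exact: cvg_snd. Qed.

Lemma preimage_fst (S T : Type) (A : set S) : fst @^-1` A = A `*` [set: T].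
Proof. by apply/seteqP; split => -[x y] //= []. Qed.

Lemma preimage_snd (S T : Type) (A : set T) : snd @^-1` A = [set: S] `*` A.
Proof. by apply/seteqP; split => -[x y] //= []. Qed.

Section gluing.
Context {R : realType} (X Y : ptopologicalType).
Context (hX : hausdorff_space X) (hY : hausdorff_space Y).
Context (mu1 mu2 : probability (borel X) R).
Context (sigma1 : probability (borel (X * Y)%type) R).
Context (a : X * X -> R) (c : R).
Context (rmu2 : radon mu2) (rsigma1 : radon sigma1).
Context (sigma1_mu1 : forall A : set (borel X), measurable A ->
  sigma1 (fst @^-1` A) = mu1 A).
Context (ca : continuous a) (a0 : forall p, 0 <= a p).
(** The easy half of Kantorovich duality for the cost [a] and the value [c], in a form homogeneous
    in the weight [t]. *)
Context (mu12 : forall (t : R) (k h : X -> R), 0 <= t ->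
  bounded_measurable (k : borel X -> R) ->
  bounded_measurable (h : borel X -> R) ->
  (forall x x', k x <= h x' + t * a (x, x')) ->
  \int[mu1]_x k x <= \int[mu2]_x h x + t * c).

Let Z : ptopologicalType := ((X * Y) * X)%type.

(** [g] and [h] may have either sign, so the cone fixes their prices; [t] is nonnegative, so the
    cost is only bounded from above. *)
Let C : set ((Z -> R) * R) := [set Gv | exists (g : X * Y -> R) (h : X -> R) (t : R),
  [/\ bounded_measurable (g : borel (X * Y)%type -> R),
      bounded_measurable (h : borel X -> R),
      0 <= t,
      forall z : Z, Gv.1 z = g z.1 + h z.2 + t * a (z.1.1, z.2) &
      Gv.2 = \int[sigma1]_p g p + \int[mu2]_x h x + t * c]].

(** Nonnegativity of [G] says that [g (x, y)] is at least every [- h x' - t a (x, x')]. Their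
    supremum [L x] no longer depends on [y], so its [mu1]-integral is at most the price of [g], and
    [mu12] for [k = - L] compares it with the price of the rest. *)
Let arbitrage_free G v : C (G, v) -> (forall z, 0 <= G z) -> 0 <= v.
Proof.
move=> [g [h [t [bg bh t0 /= GE ->]]]] G0.
have [M gM] := bg.2.
have [N hN] := bh.2.
(* The cut at [- M] keeps the family bounded; [g] stays above it because [g >= - M]. *)
pose l x' x := Num.max (- h x' - t * a (x, x')) (- M).
have M0 : 0 <= M by apply: le_trans (gM point).
have N0 : 0 <= N by apply: le_trans (hN point).
have lMN x' x : `|l x' x| <= M + N.
  have := hN x'; rewrite !ler_norml => /andP[Nh hN'].
  have ta : 0 <= t * a (x, x') by exact: mulr_ge0.
  rewrite /l le_max ge_max; apply/andP; split; last by apply/andP; split; lra.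
  by apply/orP; right; lra.
pose L x := sup (range (l ^~ x)).
have bL : bounded_measurable (L : borel X -> R).
  split; last by exists (M + N) => x; exact: sup_range_bounded.
  apply: lsc_measurable; apply: (@lsc_sup _ _ _ _ (M + N)); last first.
    by move=> x' x; rewrite (le_trans (ler_norm _)).
  move=> x'; apply: lsc_max; last by apply: continuous_lsc => x; exact: cvg_cst.
  apply: continuous_lsc => x.
  apply: cvgB; first exact: cvg_cst.
  apply: cvgM; first exact: cvg_cst.
  apply: (@continuous_comp _ _ _ (fun x => (x, x')) a); last exact: ca.
  by apply: cvg_pair; [exact: cvg_id|exact: cvg_cst].
have bLf : bounded_measurable ((L \o fst) : borel (X * Y)%type -> R).
  split; last by have [K LK] := bL.2; exists K => p; exact: LK.
  apply: (measurableT_comp bL.1).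
  by apply: continuous_borel_measurable => p; exact: cvg_fst.
have Lg : \int[mu1]_x L x <= \int[sigma1]_p g p.
  rewrite -(@expectation_pushforward _ _ _ _ _ sigma1 mu1 fst)//; last first.
    by apply: continuous_borel_measurable => p; exact: cvg_fst.
  apply: le_expectation => // -[x y] /=; apply: sup_range_le => x'.
  have := G0 ((x, y), x'); rewrite GE /= => g0.
  have := gM (x, y); rewrite ler_norml => /andP[Mg _].
  by rewrite /l ge_max Mg andbT; lra.
have := mu12 t0 (bounded_measurableN bL) bh; rewrite expectationN// => Lh.
have {}Lh : - (\int[mu1]_x L x) <= \int[mu2]_x h x + t * c.
  apply: Lh => x x'.
  rewrite lerNl; apply: le_trans (@le_sup_range _ _ _ (M + N) x' _).
    by rewrite /l le_max; apply/orP; left; lra.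
  by move=> j; rewrite (le_trans (ler_norm _)).
lra.
Qed.

Let pC : price_cone C.
Proof.
split.
- move=> v; exists (cst v), (cst 0), 0; split => //=.
  + exact: bounded_measurable_cst.
  + exact: bounded_measurable_cst.
  + by move=> z; rewrite mul0r !addr0.
  + by rewrite !expectation_cst mul0r !addr0.
- move=> F u G v [g [h [t [bg bh t0 /= FE ->]]]] [g' [h' [t' [bg' bh' t0' /= GE ->]]]].
  exists (fun p => g p + g' p), (fun x => h x + h' x), (t + t'); split => /=.
  + exact: bounded_measurableD.
  + exact: bounded_measurableD.
  + exact: addr_ge0.
  + by move=> z; rewrite FE GE; ring.
  + by rewrite !expectationD//; ring.
- move=> s F u s0 [g [h [t [bg bh t0 /= FE ->]]]].
  exists (fun p => s * g p), (fun x => s * h x), (s * t); split => /=.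
  + exact: bounded_measurableM.
  + exact: bounded_measurableM.
  + exact: mulr_ge0.
  + by move=> z; rewrite FE; ring.
  + by rewrite !expectationM//; ring.
- exact: arbitrage_free.
Qed.

(** A point outside the box [K1 * K2] leaves [K1] or [K2], and each of these events has a price
    below [e / 2]. *)
Let tightC e : 0 < e -> exists K, compact K /\
  exists G v, [/\ C (G, v), forall z, \1_(~` K) z <= G z & v <= e].
Proof.
move=> e0; have e2 : 0 < e / 2 by rewrite divr_gt0.
have [K1 [cK1 _ K1e]] := rsigma1 measurableT e2.
have [K2 [cK2 _ K2e]] := rmu2 measurableT e2.
have mK1 := compact_borel (hausdorff_prod hX hY) cK1.
have mK2 := compact_borel hX cK2.
exists (K1 `*` K2); split; first exact: compact_setX.
exists (fun z => \1_(~` K1) z.1 + \1_(~` K2) z.2),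
  (fine (sigma1 (~` K1)) + fine (mu2 (~` K2))); split.
- exists \1_(~` K1), \1_(~` K2), 0; split => //=.
  + by apply: bounded_measurable_indic; exact: measurableC.
  + by apply: bounded_measurable_indic; exact: measurableC.
  + by move=> z; rewrite mul0r addr0.
  + by rewrite !expectation_indic ?mul0r ?addr0//; exact: measurableC.
- move=> z; rewrite !indicE -natrD ler_nat !in_setC.
  rewrite (_ : (z \in K1 `*` K2) = (z.1 \in K1) && (z.2 \in K2)).
    by case: (z.1 \in K1); case: (z.2 \in K2).
  by apply/idP/andP => [/set_mem[? ?]|[/set_mem ? /set_mem ?]]; [split|]; exact: mem_set.
- rewrite [e](splitr e); apply: lerD; rewrite -lee_fin fineK.
  + by rewrite -setTD ltW.
  + by rewrite fin_num_measure//; exact: measurableC.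
  + by rewrite -setTD ltW.
  + by rewrite fin_num_measure//; exact: measurableC.
Qed.

Let lsc_az m : lsc (fun z : Z => Num.min (a (z.1.1, z.2)) m).
Proof.
apply: lsc_min; apply: continuous_lsc => z; last exact: cvg_cst.
apply: (@continuous_comp _ _ _ (fun z : Z => (z.1.1, z.2)) a); last exact: ca.
apply: cvg_pair; last exact: cvg_snd.
by apply: (@continuous_comp _ _ _ fst fst); exact: cvg_fst.
Qed.

(** Indicators of open sets of one component are payoffs of the cone; the bounds obtained for the
    image measures become equalities by [radon_eq]. *)
Lemma gluing : exists gamma : probability (borel Z) R,
  [/\ radon gamma,
      forall A : set (borel (X * Y)%type), measurable A ->
        gamma (fst @^-1` A) = sigma1 A,
      forall B : set (borel X), measurable B -> gamma (snd @^-1` B) = mu2 B &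
      (\int[gamma]_z (a (z.1.1, z.2))%:E <= c%:E)%E].
Proof.
have hZ := hausdorff_prod (hausdorff_prod hX hY) hX.
have [gamma rgamma Hgamma] := radon_of_price_cone hZ pC tightC.
have cfst : continuous (fst : Z -> X * Y) by move=> z; exact: cvg_fst.
have csnd : continuous (snd : Z -> X) by move=> z; exact: cvg_snd.
have gU (U : set Z) v G : open U -> C (G, v) -> (forall z, \1_U z <= G z) ->
    (gamma U <= v%:E)%E.
  move=> oU CG UG.
  have := Hgamma _ _ _ (open_lsc_indic oU) (is_bounded_indic _) CG UG.
  rewrite expectation_indic; last exact: open_borel.
  by rewrite -lee_fin fineK// fin_num_measure//; exact: open_borel.
exists gamma; split => //.
- have [nu rnu nuE] := radon_image hZ (hausdorff_prod hX hY) cfst rgamma.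
  move=> A mA; rewrite nuE//; apply: radon_eq => //; first exact: hausdorff_prod.
  move=> U oU; have mU := open_borel oU; rewrite -nuE//.
  rewrite -[leRHS]fineK ?fin_num_measure//; apply: (gU _ _ (fun z => \1_U z.1)) => //.
    by apply: open_comp.
  exists \1_U, (cst 0), 0; split => //=.
  + exact: bounded_measurable_indic.
  + exact: bounded_measurable_cst.
  + by move=> z; rewrite mul0r !addr0.
  + by rewrite expectation_indic// expectation_cst mul0r !addr0.
- have [nu rnu nuE] := radon_image hZ hX csnd rgamma.
  move=> A mA; rewrite nuE//; apply: radon_eq => //.
  move=> U oU; have mU := open_borel oU; rewrite -nuE//.
  rewrite -[leRHS]fineK ?fin_num_measure//; apply: (gU _ _ (fun z => \1_U z.2)) => //.
    by apply: open_comp.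
  exists (cst 0), \1_U, 0; split => //=.
  + exact: bounded_measurable_cst.
  + exact: bounded_measurable_indic.
  + by move=> z; rewrite mul0r add0r !addr0.
  + by rewrite expectation_indic// expectation_cst mul0r add0r !addr0.
(* Only bounded functions are controlled by prices, so the cost is bounded for its truncations and
   then by monotone convergence. *)
- pose f (m : nat) (z : borel Z) : \bar R := (Num.min (a (z.1.1, z.2)) m%:R)%:E.
  have bf (m : nat) : bounded_measurable
      ((fun z => Num.min (a (z.1.1, z.2)) m%:R) : borel Z -> R).
    split; first by apply: lsc_measurable; exact: lsc_az.
    exists m%:R => z; rewrite ger0_norm ?ge_min ?lexx ?orbT//.
    by rewrite le_min a0 ler0n.
  have fc m : (\int[gamma]_z f m z <= c%:E)%E.
    rewrite /f -EFin_expectation// lee_fin.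
    apply: (Hgamma _ (fun z => a (z.1.1, z.2))).
    + exact: lsc_az.
    + exact: (bf m).2.
    + exists (cst 0), (cst 0), 1; split => //=.
      * exact: bounded_measurable_cst.
      * exact: bounded_measurable_cst.
      * by move=> z; rewrite mul1r !add0r.
      * by rewrite !expectation_cst mul1r !add0r.
    + by move=> z; rewrite ge_min lexx.
  have fcvg z : f m z @[m --> \oo] --> (a (z.1.1, z.2))%:E.
    apply: cvg_near_cst; near=> m; rewrite /f min_l//.
    rewrite (le_trans (ler_norm _))//; near: m; exact: nbhs_infty_ger.
  rewrite (_ : (fun z => _) = (fun z => limn (f ^~ z))); last first.
    by apply/funext => z; apply/esym/cvg_lim.
  have mf m : measurable_fun setT (f m).
    by apply/measurable_EFinP; have [] := bf m.
  have f0 m z : setT z -> (0 <= f m z)%E.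
    by move=> _; rewrite lee_fin le_min a0 ler0n.
  have nf z : setT z -> nondecreasing_seq (f ^~ z).
    move=> _ m n mn; rewrite lee_fin le_min !ge_min lexx /=.
    by rewrite ler_nat mn orbT.
  rewrite monotone_convergence//.
  apply: lime_le; last by apply: nearW => m; exact: fc.
  apply: ereal_nondecreasing_is_cvgn => m n mn.
  apply: ge0_le_integral => //; try by move=> z _; exact: f0.
  by move=> z _; exact: nf.
Unshelve. all: by end_near. Qed.

End gluing.

(** * Transfer of the Kantorovich cost *)

Section cost_transfer.
Context {R : realType} (X Y : ptopologicalType).
Context (hX : hausdorff_space X) (hY : hausdorff_space Y).
Context (mu1 mu2 : probability (borel X) R) (nu : probability (borel Y) R).
Context (alpha : X * X -> R) (beta : Y * Y -> R).
Context (rmu2 : radon mu2).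
Context (calpha : continuous alpha) (alpha0 : forall p, 0 <= alpha p).
Context (cbeta : continuous beta) (beta0 : forall p, 0 <= beta p).
Context (beta_diag : forall y, beta (y, y) = 0).
Context (sigma1 : probability (borel (X * Y)%type) R).
Context (csigma1 : coupling mu1 nu sigma1).

(* Besides [a := alpha] this is used with [a := 0], which still provides a
   coupling when [kantorovich_cost alpha mu1 mu2] is infinite. *)
Lemma coupling_from_gluing (a : X * X -> R) (c : R) :
  continuous a -> (forall p, 0 <= a p) ->
  (forall (t : R) (k h : X -> R), 0 <= t ->
    bounded_measurable (k : borel X -> R) ->
    bounded_measurable (h : borel X -> R) ->
    (forall x x', k x <= h x' + t * a (x, x')) ->
    \int[mu1]_x k x <= \int[mu2]_x h x + t * c) ->
  exists2 sigma2, coupling mu2 nu sigma2 &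
    (kantorovich_cost (oplus a beta) sigma1 sigma2 <= c%:E)%E.
Proof.
move=> ca a0 Hc; have [rs1 s1mu s1nu] := csigma1.
have hXY := hausdorff_prod hX hY.
have [|gamma [rg g1 g2 gc]] := gluing hX hY rmu2 rs1 _ ca a0 Hc.
  by move=> A mA; rewrite preimage_fst s1mu.
pose Z : ptopologicalType := ((X * Y) * X)%type.
(* For [z = ((x, y), x')], the law of [p z = (x', y)] will be [sigma2], and that of [q z] couples
   [sigma1] with [sigma2] while keeping [y]. *)
pose p (z : Z) : X * Y := (z.2, z.1.2).
pose q (z : Z) : (X * Y) * (X * Y) := (z.1, p z).
have cp : continuous p.
  apply: continuous_pair; first exact: continuous_snd.
  by move=> z; apply: (@continuous_comp _ _ _ fst snd);
    [exact: continuous_fst|exact: continuous_snd].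
have cq : continuous q.
  by apply: continuous_pair => //; exact: continuous_fst.
have hZ : hausdorff_space Z by exact: hausdorff_prod.
have [s2 rs2 s2E] := radon_image hZ hXY cp rg.
have [tau rtau tauE] := radon_image hZ (hausdorff_prod hXY hXY) cq rg.
have mfst : measurable_fun setT (fst : borel (X * Y)%type -> borel X).
  by apply: continuous_borel_measurable => z; exact: cvg_fst.
have msnd : measurable_fun setT (snd : borel (X * Y)%type -> borel Y).
  by apply: continuous_borel_measurable => z; exact: cvg_snd.
exists s2.
  split => // [A mA|B mB].
    rewrite -preimage_fst -s2E; last by rewrite -[X in measurable X]setTI; exact: mfst.
    by rewrite -g2.
  have mB' : measurable (snd @^-1` B : set (borel (X * Y)%type)).
    by rewrite -[X in measurable X]setTI; exact: msnd.
  by rewrite -preimage_snd -s2E// -s1nu// -preimage_snd -g1.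
have coplus : continuous (oplus a beta).
  move=> z; apply: cvgD.
  - apply: (@continuous_comp _ _ _ (fun z => (z.1.1, z.2.1)) a); last exact: ca.
    by apply: continuous_pair => {}z; apply: (@continuous_comp _ _ _ _ fst);
      (exact: continuous_fst || exact: continuous_snd).
  - apply: (@continuous_comp _ _ _ (fun z => (z.1.2, z.2.2)) beta); last exact: cbeta.
    by apply: continuous_pair => {}z; apply: (@continuous_comp _ _ _ _ snd);
      (exact: continuous_fst || exact: continuous_snd).
have mpre (S T : ptopologicalType) (f : S -> T) (B : set (borel T)) :
    continuous f -> measurable B -> measurable (f @^-1` B : set (borel S)).
  move=> cf mB; rewrite -[X in measurable X]setTI.
  exact: (continuous_borel_measurable cf).
apply: (@le_trans _ _ (\int[tau]_z (oplus a beta z)%:E)%E).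
  apply: ereal_inf_lbound; exists tau => //; split => // [A mA|B mB].
    by rewrite -preimage_fst -tauE ?g1//; apply: mpre => //; exact: continuous_fst.
  by rewrite -preimage_snd -tauE ?s2E//; apply: mpre => //; exact: continuous_snd.
rewrite -(@ge0_integral_image _ _ _ _ _ gamma tau q).
(* Both points of [q z] have the same component [y], so [beta] contributes nothing. *)
- apply: le_trans gc; rewrite le_eqVlt; apply/orP; left; apply/eqP.
  by apply: eq_integral => z _; rewrite /oplus /= beta_diag addr0.
- exact: continuous_borel_measurable.
- exact: tauE.
- by apply/measurable_EFinP; apply: lsc_measurable; exact: continuous_lsc.
- by move=> z; rewrite lee_fin addr_ge0.
Qed.

(** The constant [sup (range k)] separates [k] from [h]. *)
Let expectation_le_const (k h : X -> R) :
  bounded_measurable (k : borel X -> R) -> bounded_measurable (h : borel X -> R) ->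
  (forall x x', k x <= h x') -> \int[mu1]_x k x <= \int[mu2]_x h x.
Proof.
move=> bk bh kh; have [M kM] := bk.2.
have kk x : k x <= sup (range k).
  by apply: (@le_sup_range _ _ _ M) => j; rewrite (le_trans (ler_norm _)).
apply: (@le_trans _ _ (sup (range k))).
  rewrite -[leRHS](expectation_cst mu1); apply: le_expectation => //.
  exact: bounded_measurable_cst.
rewrite -[leLHS](expectation_cst mu2); apply: le_expectation => //.
  exact: bounded_measurable_cst.
by move=> x; apply: sup_range_le => x'.
Qed.

(** Weak duality: the inequality is integrated against an arbitrary coupling. *)
Let expectation_le_cost (k h : X -> R) :
  bounded_measurable (k : borel X -> R) -> bounded_measurable (h : borel X -> R) ->
  (forall x x', k x <= h x' + alpha (x, x')) ->
  ((\int[mu1]_x k x - \int[mu2]_x h x)%:E <= kantorovich_cost alpha mu1 mu2)%E.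
Proof.
move=> bk bh kh; apply: le_ereal_inf_tmp => _ [pi [rpi pi1 pi2] <-].
have malpha : measurable_fun setT
    ((fun z => (alpha z)%:E) : borel (X * X)%type -> \bar R).
  by apply/measurable_EFinP; apply: lsc_measurable; exact: continuous_lsc.
have mfst : measurable_fun setT (fst : borel (X * X)%type -> borel X).
  by apply: continuous_borel_measurable; exact: continuous_fst.
have msnd : measurable_fun setT (snd : borel (X * X)%type -> borel X).
  by apply: continuous_borel_measurable; exact: continuous_snd.
have bkf : bounded_measurable ((k \o fst) : borel (X * X)%type -> R).
  split; first exact: (measurableT_comp bk.1).
  by have [M kM] := bk.2; exists M => z; exact: kM.
have bhs : bounded_measurable ((h \o snd) : borel (X * X)%type -> R).
  split; first exact: (measurableT_comp bh.1).
  by have [M hM] := bh.2; exists M => z; exact: hM.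
have -> : \int[mu1]_x k x - \int[mu2]_x h x = \int[pi]_z (k z.1 - h z.2).
  rewrite (expectationD pi bkf (bounded_measurableN bhs)) expectationN//.
  rewrite -(@expectation_pushforward _ _ _ _ _ pi mu1 fst k mfst _ bk); last first.
    by move=> A mA; rewrite preimage_fst pi1.
  rewrite -(@expectation_pushforward _ _ _ _ _ pi mu2 snd h msnd _ bh)//.
  by move=> A mA; rewrite preimage_snd pi2.
(* A coupling of infinite cost is no constraint; otherwise [alpha] is integrable and the integrals
   can be compared. *)
have [->|fin] := eqVneq (\int[pi]_z (alpha z)%:E)%E +oo%E; first by rewrite leey.
have bkh := bounded_measurableD bkf (bounded_measurableN bhs).
rewrite EFin_expectation//; apply: le_integral => //.
- exact: bounded_measurable_integrable.
- apply/integrableP; split => //.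
  under eq_integral do rewrite gee0_abs ?lee_fin//.
  by rewrite ltey.
- by move=> z _; rewrite lee_fin; have := kh z.1 z.2; rewrite -surjective_pairing; lra.
Qed.

(** For a finite cost, weak duality applied to [t^-1 k] and [t^-1 h] gives the inequality required
    by the gluing; [t = 0] is the separation by a constant. *)
Lemma cost_transfer : exists2 sigma2, coupling mu2 nu sigma2 &
  (kantorovich_cost (oplus alpha beta) sigma1 sigma2 <=
   kantorovich_cost alpha mu1 mu2)%E.
Proof.
have K0 : (0 <= kantorovich_cost alpha mu1 mu2)%E.
  by apply: le_ereal_inf_tmp => _ [pi _ <-]; apply: integral_ge0 => z _; rewrite lee_fin.
case: (kantorovich_cost alpha mu1 mu2) K0 expectation_le_cost => [K| |] //.
- rewrite lee_fin => K0 HK; apply: coupling_from_gluing => // t k h t0 bk bh kh.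
  move: t0; rewrite le_eqVlt => /predU1P[t0|t0].
    rewrite -t0 mul0r addr0; apply: expectation_le_const => // x x'.
    by have := kh x x'; rewrite -t0 mul0r addr0.
  have ti : 0 <= t^-1 by rewrite invr_ge0 ltW.
  have := HK _ _ (bounded_measurableM t^-1 bk) (bounded_measurableM t^-1 bh).
  rewrite !expectationM// -mulrBr lee_fin ler_pdivrMl// lerBlDl; apply => x x'.
  by rewrite ler_pdivrMl// mulrDr mulrA divff ?gt_eqF// mul1r.
- move=> _ _; have [|||s2 cs2 _] := @coupling_from_gluing (cst 0) 0.
  + by move=> z; exact: cvg_cst.
  + by [].
  + move=> t k h t0 bk bh kh; rewrite mulr0 addr0.
    apply: expectation_le_const => // x x'.
    by have := kh x x'; rewrite mulr0 addr0.
  + by exists s2 => //; rewrite leey.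
Qed.

End cost_transfer.

(** * Transfer for Lipschitz functions and Kantorovich pseudometrics *)

Section lipschitz.
Context {R : realType}.

Definition lipschitz_wrt (T : Type) (d : T * T -> R) (t : R) (f : T -> R) :=
  forall x y, `|f x - f y| <= t * d (x, y).

Lemma lipschitz_wrt_continuous (T : topologicalType) (d : T * T -> R) t f :
  continuous d -> (forall x, d (x, x) = 0) -> lipschitz_wrt d t f ->
  continuous f.
Proof.
move=> cd d0 lf x; apply/cvgrPdist_lt => e e0.
have ctd : (fun y => t * d (x, y)) @ x --> (0 : R).
  rewrite -[X in _ --> X](mulr0 t) -(d0 x); apply: cvgM; first exact: cvg_cst.
  apply: (@continuous_comp _ _ _ (fun y => (x, y)) d); last exact: cd.
  by apply: cvg_pair; [exact: cvg_cst|exact: cvg_id].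
have /cvgrPdist_lt /(_ e e0) := ctd; apply: filterS => y.
rewrite sub0r normrN; apply: le_lt_trans; apply: le_trans (lf x y) _.
exact: ler_norm.
Qed.

End lipschitz.

Section lipschitz_transfer.
Context {R : realType} (I : finType) (X : I -> ptopologicalType).
(** [Z] is a product known only through its coordinates: [p_surj] prescribes them and [p_box] makes
    boxes of compact sets compact. Binary products and [prod_topology] are thus treated together. *)
Context (Z : ptopologicalType) (p : forall i, Z -> X i).
Context (hX : forall i, hausdorff_space (X i)) (hZ : hausdorff_space Z).
Context (cp : forall i, continuous (p i)).
Context (p_surj : forall x : (forall i, X i), exists z, forall i, p i z = x i).
Context (p_box : forall K : (forall i, set (X i)), (forall i, compact (K i)) ->
  compact [set z | forall i, K i (p i z)]).
Context (a : forall i, X i * X i -> R).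
Arguments a : clear implicits.
Context (ca : forall i, continuous (a i)) (pa : forall i, pseudometric (a i)).

Let a_refl i x : a i (x, x) = 0.
Proof. by have [_ + _ _] := pa i; apply. Qed.

Definition sum_dist (q : Z * Z) := \sum_i a i (p i q.1, p i q.2).

Let sum_dist_refl z : sum_dist (z, z) = 0.
Proof. by rewrite /sum_dist big1// => i _; rewrite a_refl. Qed.

Lemma sum_dist_continuous : continuous sum_dist.
Proof.
move=> q; apply: cvg_big => [|i _]; first exact: add_continuous.
apply: (@continuous_comp _ _ _ (fun q => (p i q.1, p i q.2)) (a i)); last exact: ca.
apply: continuous_pair => {}q.
  by apply: (@continuous_comp _ _ _ fst (p i)); [exact: continuous_fst|exact: cp].
by apply: (@continuous_comp _ _ _ snd (p i)); [exact: continuous_snd|exact: cp].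
Qed.

Lemma sum_dist_pseudometric : pseudometric sum_dist.
Proof.
split.
- by move=> x y; apply: sumr_ge0 => i _; have [+ _ _ _] := pa i; apply.
- exact: sum_dist_refl.
- by move=> x y; apply: eq_bigr => i _; have [_ _ + _] := pa i; apply.
- move=> x y z; rewrite /sum_dist -big_split; apply: ler_sum => i _.
  by have [_ _ _ +] := pa i; apply.
Qed.

Let p_update i (x : X i) z : exists z', p i z' = x /\ forall j, i != j -> p j z' = p j z.
Proof.
have [z' z'E] := p_surj (dfwith (fun j => p j z) i x).
exists z'; split; first by rewrite z'E dfwithin.
by move=> j ij; rewrite z'E dfwithout.
Qed.

(** A chosen point with coordinate [x] at [i] and the other coordinates of [z]. *)
Let upd i (x : X i) z := projT1 (cid (p_update x z)).

Let p_upd i (x : X i) z : p i (upd x z) = x.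
Proof. by rewrite /upd; case: cid => z' []. Qed.

Let p_upd_neq i (x : X i) z j : i != j -> p j (upd x z) = p j z.
Proof. by rewrite /upd; case: cid => z' [z'i z'E]; exact: z'E. Qed.

Let sum_dist_upd i (x y : X i) z : sum_dist (upd x z, upd y z) = a i (x, y).
Proof.
rewrite /sum_dist (bigD1 i)//= !p_upd big1 ?addr0// => j ji.
by rewrite !p_upd_neq 1?eq_sym// a_refl.
Qed.

(** The two points have the same coordinates, hence distance zero, although the [p i] are not
    assumed to separate points. *)
Let lipschitz_upd t f i z : lipschitz_wrt sum_dist t f -> f (upd (p i z) z) = f z.
Proof.
move=> lf; apply/eqP; rewrite -subr_eq0 -normr_le0.
apply: le_trans (lf _ _) _; rewrite /sum_dist big1 ?mulr0// => j _ /=.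
have [ij|ij] := eqVneq i j; last by rewrite p_upd_neq// a_refl.
by case: j / ij; rewrite p_upd a_refl.
Qed.

(* One coordinate at a time, [phi i] is replaced by the supremum over the other
   coordinates of [f] minus the remaining [phi j], which inherits the Lipschitz
   bound of [f]. *)
Lemma lipschitz_domination (phi : forall i, X i -> R) (f : Z -> R) (t : R) :
  0 <= t -> (forall i, bounded_measurable (phi i : borel (X i) -> R)) ->
  is_bounded f -> lipschitz_wrt sum_dist t f ->
  (forall z, f z <= \sum_i phi i (p i z)) ->
  exists psi : forall i, X i -> R,
  [/\ forall i, bounded_measurable (psi i : borel (X i) -> R),
      forall i x, psi i x <= phi i x,
      forall i, lipschitz_wrt (a i) t (psi i) &
      forall z, f z <= \sum_i psi i (p i z)].
Proof.
move=> t0 bphi bf lf fphi.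
(* Induction over the list of coordinates already made Lipschitz. *)
suff : forall s : seq I, exists psi : forall i, X i -> R,
  [/\ forall i, bounded_measurable (psi i : borel (X i) -> R),
      forall i x, psi i x <= phi i x,
      forall i, i \in s -> lipschitz_wrt (a i) t (psi i) &
      forall z, f z <= \sum_i psi i (p i z)].
  move=> /(_ (enum I))[psi [bpsi psiphi lpsi fpsi]]; exists psi; split => // i.
  by apply: lpsi; rewrite mem_enum.
elim => [|i s [psi [bpsi psiphi lpsi fpsi]]]; first by exists phi.
pose others z := \sum_(j | j != i) psi j (p j z).
have fE z : \sum_j psi j (p j z) = psi i (p i z) + others z by rewrite (bigD1 i).
have [M fM] := bf.
have [N oN] : is_bounded others.
  rewrite /others; under eq_fun do rewrite -big_filter.
  apply: (@is_bounded_sum _ _ _ _ (fun j z => psi j (p j z))) => j.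
  by have [K psiK] := (bpsi j).2; exists K => z; exact: psiK.
have others_upd (x : X i) z : others (upd x z) = others z.
  by apply: eq_bigr => j ji; rewrite p_upd_neq// eq_sym.
pose u (x : X i) z := f (upd x z) - others z.
have uMN x z : `|u x z| <= M + N.
  by rewrite (le_trans (ler_normB _ _))// lerD.
have uMN' x z : u x z <= M + N by rewrite (le_trans (ler_norm _)).
pose psi' (x : X i) := sup (range (u x)).
(* [upd x z] and [upd y z] differ only at [i], and [others z] cancels, so each [u] inherits the
   bound of [f] and so does the supremum. *)
have lpsi' : lipschitz_wrt (a i) t psi'.
  have half x y : psi' x <= psi' y + t * a i (x, y).
    apply: sup_range_le => z; rewrite -lerBlDr.
    apply: (@le_trans _ _ (u y z)); last exact: (@le_sup_range _ _ _ (M + N)).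
    have := lf (upd x z) (upd y z); rewrite sum_dist_upd ler_norml => /andP[_].
    by rewrite /u; lra.
  move=> x y; rewrite ler_norml; have := half x y; have := half y x.
  have [_ _ a_sym _] := pa i; rewrite a_sym => h1 h2; apply/andP; split; lra.
have bpsi' : bounded_measurable (psi' : borel (X i) -> R).
  split; last by exists (M + N) => x; exact: sup_range_bounded.
  apply: lsc_measurable; apply: continuous_lsc.
  by apply: lipschitz_wrt_continuous (ca (i := i)) _ lpsi' => x; rewrite a_refl.
have psi'psi x : psi' x <= psi i x.
  apply: sup_range_le => z; rewrite lerBlDr.
  by apply: le_trans (fpsi _) _; rewrite fE p_upd others_upd.
exists (dfwith psi i psi'); split.
- by move=> j; case: dfwithP.
- move=> j; case: dfwithP => [x|k _ x]; last exact: psiphi.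
  exact: le_trans (psi'psi x) (psiphi i x).
- move=> j; rewrite in_cons; case: dfwithP => [//|k ik].
  by rewrite eq_sym (negbTE ik) /=; exact: lpsi.
- move=> z; rewrite (bigD1 i)//= dfwithin.
  rewrite (eq_bigr (fun j => psi j (p j z))); last first.
    by move=> j ji; rewrite dfwithout// eq_sym.
  (* The supremum includes the value at [z] itself, whose coordinate at [i] is already [p i z]. *)
  rewrite -lerBlDr -(lipschitz_upd i z lf).
  exact: (@le_sup_range _ _ (u (p i z)) (M + N)).
Qed.

(** * The price cone of coordinate functions and Lipschitz functions *)

Section transfer.
Context (mu nu : forall i, probability (borel (X i)) R).
Context (sigma : probability (borel Z) R) (D : I -> R).
Context (rnu : forall i, radon (nu i)).
Context (sigma_mu : forall i (A : set (borel (X i))), measurable A ->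
  sigma (p i @^-1` A) = mu i A).
Context (munuD : forall i t (f : X i -> R), 0 <= t ->
  bounded_measurable (f : borel (X i) -> R) -> lipschitz_wrt (a i) t f ->
  \int[mu i]_x f x <= \int[nu i]_x f x + t * D i).

(** One [f] is enough, as Lipschitz constants add up along with the weights [t]. *)
Let C : set ((Z -> R) * R) := [set Gv |
  exists (phi : forall i, X i -> R) (f : Z -> R) (t : R),
  [/\ forall i, bounded_measurable (phi i : borel (X i) -> R),
      is_bounded f /\ lipschitz_wrt sum_dist t f,
      0 <= t,
      forall z : Z, Gv.1 z = \sum_i phi i (p i z) - f z &
      Gv.2 = \sum_i \int[nu i]_x phi i x + t * (\sum_i D i) - \int[sigma]_z f z]].

Let lip_bounded_measurable f t : is_bounded f -> lipschitz_wrt sum_dist t f ->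
  bounded_measurable (f : borel Z -> R).
Proof.
move=> bf lf; split => //; apply: lsc_measurable; apply: continuous_lsc.
apply: lipschitz_wrt_continuous lf; first exact: sum_dist_continuous.
exact: sum_dist_refl.
Qed.

(** After [lipschitz_domination] the bound on [f] is integrated against [sigma], and [munuD] moves
    each Lipschitz [psi i] from [mu i] to [nu i] before it is compared with [phi i]. *)
Let arbitrage_free G v : C (G, v) -> (forall z, 0 <= G z) -> 0 <= v.
Proof.
move=> [phi [f [t [bphi [bf lf] t0 /= GE ->]]]] G0.
have fphi z : f z <= \sum_i phi i (p i z) by rewrite -subr_ge0 -GE.
have [psi [bpsi psiphi lpsi fpsi]] := lipschitz_domination t0 bphi bf lf fphi.
have mp i : measurable_fun setT (p i : borel Z -> borel (X i)).
  exact: continuous_borel_measurable.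
have bpsip i : bounded_measurable ((fun z => psi i (p i z)) : borel Z -> R).
  split; first exact: (measurableT_comp (bpsi i).1).
  by have [M psiM] := (bpsi i).2; exists M => z; exact: psiM.
rewrite subr_ge0.
apply: (@le_trans _ _ (\int[sigma]_z \sum_i psi i (p i z))).
  apply: le_expectation => //; first exact: lip_bounded_measurable lf.
  exact: bounded_measurable_sum.
rewrite expectation_sum// mulr_sumr -big_split; apply: ler_sum => i _ /=.
rewrite (@expectation_pushforward _ _ _ _ _ sigma (mu i) (p i) (psi i))//.
  apply: le_trans (munuD t0 (bpsi i) (lpsi i)) _.
  by rewrite lerD2r; apply: le_expectation.
by move=> A mA; exact: sigma_mu.
Qed.

Let pC : price_cone C.
Proof.
split.
(* Cash is carried by [f], since a constant has Lipschitz constant [0]. *)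
- move=> v; exists (fun=> cst 0), (cst (- v)), 0; split => //=.
  + by move=> i; exact: bounded_measurable_cst.
  + split; first exact: is_bounded_cst.
    by move=> x y; rewrite subrr normr0 mul0r.
  + by move=> z; rewrite big1// sub0r opprK.
  + rewrite big1 ?expectation_cst ?mul0r ?add0r ?opprK// => i _.
    by rewrite expectation_cst.
- move=> F u G v [phi [f [t [bphi [bf lf] t0 /= FE ->]]]]
    [phi' [f' [t' [bphi' [bf' lf'] t0' /= GE ->]]]].
  exists (fun i x => phi i x + phi' i x), (fun z => f z + f' z), (t + t'); split => /=.
  + by move=> i; exact: (bounded_measurableD (bphi i) (bphi' i)).
  + split; first exact: is_boundedD.
    move=> x y; rewrite mulrDl opprD addrACA.
    by rewrite (le_trans (ler_normD _ _))// lerD.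
  + exact: addr_ge0.
  + by move=> z; rewrite FE GE big_split /=; ring.
  + rewrite expectationD; [|exact: lip_bounded_measurable lf|exact: lip_bounded_measurable lf'].
    have -> : \sum_i \int[nu i]_x (phi i x + phi' i x) =
        \sum_i \int[nu i]_x phi i x + \sum_i \int[nu i]_x phi' i x.
      by rewrite -big_split; apply: eq_bigr => i _; exact: expectationD.
    by ring.
- move=> s F u s0 [phi [f [t [bphi [bf lf] t0 /= FE ->]]]].
  exists (fun i x => s * phi i x), (fun z => s * f z), (s * t); split => /=.
  + by move=> i; exact: (bounded_measurableM s (bphi i)).
  + split; first by apply: is_boundedM => //; exact: is_bounded_cst.
    by move=> x y; rewrite -mulrBr normrM (ger0_norm s0) -mulrA ler_wpM2l.
  + exact: mulr_ge0.
  + by move=> z; rewrite FE -mulr_sumr; ring.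
  + rewrite expectationM; last exact: lip_bounded_measurable lf.
    have -> : \sum_i \int[nu i]_x (s * phi i x) = s * \sum_i \int[nu i]_x phi i x.
      by rewrite mulr_sumr; apply: eq_bigr => i _; exact: expectationM.
    by ring.
- exact: arbitrage_free.
Qed.

Let tightC e : 0 < e -> exists K, compact K /\
  exists G v, [/\ C (G, v), forall z, \1_(~` K) z <= G z & v <= e].
Proof.
(* The successor keeps the denominator positive when [I] is empty. *)
move=> e0; pose e' := e / (#|I|.+1)%:R.
have e'0 : 0 < e' by rewrite divr_gt0.
have H i := cid (rnu (i := i) measurableT e'0).
pose K i := projT1 (H i).
have cK i : compact (K i) by rewrite /K; case: (H i) => ? [].
have Ke i : (nu i (~` K i) < e'%:E)%E.
  by rewrite /K; case: (H i) => ? /= [_ _]; rewrite setTD.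
have mK i : measurable (~` K i : set (borel (X i))).
  by apply: measurableC; exact: compact_borel.
exists [set z | forall i, K i (p i z)]; split; first exact: p_box.
exists (fun z => \sum_i \1_(~` K i) (p i z)), (\sum_i fine (nu i (~` K i))); split.
- exists (fun i => \1_(~` K i)), (cst 0), 0; split => //=.
  + by move=> i; exact: (bounded_measurable_indic R (mK i)).
  + split; first exact: is_bounded_cst.
    by move=> x y; rewrite subrr normr0 mul0r.
  + by move=> z; rewrite subr0.
  + rewrite mul0r addr0 expectation_cst subr0.
    by apply: eq_bigr => i _; rewrite -expectation_indic//; exact: mK.
- move=> z; rewrite indicE; case: (boolP (z \in _)) => [|_]; last first.
    by apply: sumr_ge0 => i _; rewrite indicE.
  move=> /set_mem /existsNP[i Kiz]; rewrite (bigD1 i)//= indicE mem_set//.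
  by rewrite lerDl; apply: sumr_ge0 => j _; rewrite indicE.
- apply: (@le_trans _ _ (\sum_(i : I) e')).
    apply: ler_sum => i _; rewrite -lee_fin fineK ?fin_num_measure//.
    exact: ltW.
  rewrite sumr_const -mulr_natr /e' -mulrA ger_pMr// mulrC ler_pdivrMr// mul1r.
  by rewrite ler_nat.
Qed.

(** The marginals follow from indicators of open sets and [radon_eq]; the last bound is the price of
    [- f], which is continuous and belongs to the cone with [t = 1]. *)
Lemma lipschitz_transfer : exists gamma : probability (borel Z) R,
  [/\ radon gamma,
      forall i (A : set (borel (X i))), measurable A ->
        gamma (p i @^-1` A) = nu i A &
      forall f, bounded_measurable (f : borel Z -> R) -> lipschitz_wrt sum_dist 1 f ->
        \int[sigma]_z f z - \int[gamma]_z f z <= \sum_i D i].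
Proof.
have [gamma rgamma Hgamma] := radon_of_price_cone hZ pC tightC.
exists gamma; split => //.
- move=> i; have [nu' rnu' nu'E] := radon_image hZ (hX (i := i)) (cp (i := i)) rgamma.
  move=> A mA; rewrite nu'E//; apply: radon_eq => // U oU.
  have mU := open_borel oU; rewrite -nu'E//.
  have opU : open (p i @^-1` U) by apply: open_comp => // z _; exact: cp.
  have mpU := open_borel opU.
  rewrite -[leLHS]fineK ?fin_num_measure// -[leRHS]fineK ?fin_num_measure// lee_fin.
  rewrite -expectation_indic//.
  apply: (Hgamma _ (fun z => \1_U (p i z))) => //.
  + exact: open_lsc_indic.
  + exact: is_bounded_indic.
  + exists (dfwith (fun j => cst 0) i (\1_U : X i -> R)), (cst 0), 0; split => //=.
    * move=> j; case: dfwithP => [|k _]; first exact: bounded_measurable_indic.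
      exact: bounded_measurable_cst.
    * split; first exact: is_bounded_cst.
      by move=> x y; rewrite subrr normr0 mul0r.
    * move=> z; rewrite (bigD1 i)//= dfwithin big1 ?subr0 ?addr0// => j ji.
      by rewrite dfwithout// eq_sym.
    * rewrite (bigD1 i)//= dfwithin expectation_indic// expectation_cst mul0r.
      rewrite big1 ?subr0 ?addr0// => j ji.
      by rewrite dfwithout ?expectation_cst// eq_sym.
- move=> f bf lf.
  suff : \int[gamma]_z (- f z) <= \sum_i D i - \int[sigma]_z f z.
    by rewrite expectationN//; lra.
  apply: (Hgamma _ (fun z => - f z)) => //.
  + apply: continuous_lsc => z; apply: cvgN; move: z.
    by apply: lipschitz_wrt_continuous sum_dist_continuous sum_dist_refl lf.
  + exact: is_boundedN bf.2.
  + exists (fun=> cst 0), f, 1; split => //=.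
    * by move=> i; exact: bounded_measurable_cst.
    * by split => //; exact: bf.2.
    * by move=> z; rewrite big1// sub0r.
    * rewrite mul1r [X in _ = X + _ - _]big1 ?add0r// => i _.
      by rewrite expectation_cst.
Qed.

End transfer.

End lipschitz_transfer.

(** * The Kantorovich pseudometric and its bounded test functions *)

Section kantorovich_dist_lemmas.
Context {R : realType} (T : ptopologicalType) (d : T * T -> R).
Context (cd : continuous d) (pd : pseudometric d).
Implicit Types (mu nu : probability (borel T) R) (f : T -> R).
Local Open Scope ereal_scope.

Lemma lipschitz_measurable f t : lipschitz_wrt d t f ->
  measurable_fun setT (f : borel T -> R).
Proof.
move=> lf; apply: lsc_measurable; apply: continuous_lsc.
by apply: lipschitz_wrt_continuous cd _ lf; have [_ + _ _] := pd.
Qed.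

(** [|f x|] is at most [|f x0| + d (x, x0)]. *)
Lemma lipschitz_integrable mu x0 f : dist_integrable d mu x0 ->
  lipschitz_wrt d 1 f -> mu.-integrable setT (fun x => (f x)%:E).
Proof.
move=> id lf; have [d0 _ _ _] := pd.
have ig : mu.-integrable setT (fun x => (`|f x0|)%:E + (d (x, x0))%:E).
  apply: integrableD => //.
  exact: (bounded_measurable_integrable mu (bounded_measurable_cst _ _)).
apply: (le_integrable measurableT _ _ ig).
- by apply/measurable_EFinP; exact: lipschitz_measurable lf.
- move=> x _; rewrite -EFinD lee_fin [leRHS]ger0_norm ?addr_ge0//.
  have := lf x x0; rewrite mul1r => fx.
  by rewrite -[f x](subrK (f x0)) addrC (le_trans (ler_normD _ _))// lerD2l.
Qed.

Lemma kantorovich_dist_ge mu nu f : bounded_measurable (f : borel T -> R) ->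
  lipschitz_wrt d 1 f ->
  (\int[mu]_x f x - \int[nu]_x f x)%:E <= kantorovich_dist d mu nu.
Proof.
move=> bf lf; apply: ereal_sup_ubound; exists f.
  by move=> x y; rewrite -[leRHS]mul1r; exact: lf.
by rewrite EFinB !EFin_expectation.
Qed.

Lemma kantorovich_dist_ge0 mu nu : 0 <= kantorovich_dist d mu nu.
Proof.
have [d0 _ _ _] := pd.
apply: (@le_trans _ _ (\int[mu]_x (0%R : R) - \int[nu]_x (0%R : R))%:E).
  by rewrite !expectation_cst subrr.
apply: kantorovich_dist_ge; first exact: bounded_measurable_cst.
by move=> x y; rewrite subrr normr0 mul1r.
Qed.

(** [f] and [- f] are admissible together; integrability lets the sign leave the extended
    integrals. *)
Lemma kantorovich_dist_sym mu nu x0 :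
  dist_integrable d mu x0 -> dist_integrable d nu x0 ->
  kantorovich_dist d mu nu = kantorovich_dist d nu mu.
Proof.
suff le mu' nu' : dist_integrable d mu' x0 -> dist_integrable d nu' x0 ->
    kantorovich_dist d mu' nu' <= kantorovich_dist d nu' mu'.
  by move=> imu inu; apply/le_anti/andP; split; exact: le.
move=> imu inu; apply: ge_ereal_sup => _ [f lf <-].
have lf1 : lipschitz_wrt d 1 f by move=> x y; rewrite mul1r; exact: lf.
have fmu := lipschitz_integrable imu lf1; have fnu := lipschitz_integrable inu lf1.
apply: ereal_sup_ubound; exists (fun x => - f x)%R.
  by move=> x y; rewrite -opprD normrN; exact: lf.
rewrite (_ : \int[nu']_z (- f z)%:E = - \int[nu']_z (f z)%:E); last first.
  exact: (integralN (integrable_add_def measurableT fnu)).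
rewrite (_ : \int[mu']_z (- f z)%:E = - \int[mu']_z (f z)%:E); last first.
  exact: (integralN (integrable_add_def measurableT fmu)).
by rewrite oppeK addeC.
Qed.

Let trunc (n : nat) f x : R := (Num.max (Num.min (f x) n%:R) (- n%:R))%R.

Let trunc_bounded n f : is_bounded (trunc n f).
Proof.
exists n%:R => x; rewrite /trunc ler_norml le_max ge_max ge_min !lexx !orbT /=.
by rewrite (le_trans _ (ler0n R n))// oppr_le0 ler0n.
Qed.

Let trunc_le n f x : (`|trunc n f x| <= `|f x|)%R.
Proof.
rewrite /trunc; have n0 := ler0n R n; move: (n%:R : R)%R n0 => M M0.
have := ler_norm (f x); have := ler_norm (- f x)%R; rewrite normrN ler_norml.
rewrite /Num.max /Num.min; have [?|?] := ltP (f x) M.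
  by have [?|?] := ltP (f x) (- M)%R => ? ?; apply/andP; split; lra.
by have [?|?] := ltP M (- M)%R => ? ?; apply/andP; split; lra.
Qed.

Let trunc_lipschitz n f : lipschitz_wrt d 1 f -> lipschitz_wrt d 1 (trunc n f).
Proof.
move=> lf x y; apply: le_trans (lf x y).
have max_lip (u v w : R) : (`|Num.max u w - Num.max v w| <= `|u - v|)%R.
  have := ler_norm (u - v)%R; have := ler_norm (- (u - v))%R; rewrite normrN ler_norml.
  rewrite /Num.max; have [?|?] := ltP u w; have [?|?] := ltP v w => ? ?;
    by apply/andP; split; lra.
have min_lip (u v w : R) : (`|Num.min u w - Num.min v w| <= `|u - v|)%R.
  have := ler_norm (u - v)%R; have := ler_norm (- (u - v))%R; rewrite normrN ler_norml.
  rewrite /Num.min; have [?|?] := ltP u w; have [?|?] := ltP v w => ? ?;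
    by apply/andP; split; lra.
exact: le_trans (max_lip _ _ _) (min_lip _ _ _).
Qed.

(** Dominated convergence with the integrable bound [|f|]. *)
Let trunc_cvg mu x0 f : dist_integrable d mu x0 -> lipschitz_wrt d 1 f ->
  (\int[mu]_x trunc n f x)%R @[n --> \oo] --> (\int[mu]_x f x)%R.
Proof.
move=> imu lf; have ifm := lipschitz_integrable imu lf.
suff : \int[mu]_x (trunc n f x)%:E @[n --> \oo] --> \int[mu]_x (f x)%:E.
  by rewrite -(fineK (integrable_fin_num measurableT ifm)) => /fine_cvg.
have iaf : mu.-integrable setT (fun x => `|(f x)%:E|) by exact: integrable_abse.
apply: (dominated_cvg measurableT _ _ _ iaf) => //.
- by move=> n; apply/measurable_EFinP; exact: (lipschitz_measurable (@trunc_lipschitz n f lf)).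
- move=> x _; apply: cvg_near_cst; near=> n.
  have fn : (`|f x| <= n%:R)%R by near: n; exact: nbhs_infty_ger.
  move: fn; rewrite ler_norml => /andP[fn1 fn2].
  by rewrite /trunc min_l// max_l.
- by move=> n x _; rewrite lee_fin trunc_le.
Unshelve. all: by end_near. Qed.

(** Prices control bounded functions only; truncations of a Lipschitz function stay Lipschitz and
    their integrals converge. *)
Lemma kantorovich_dist_le mu nu x0 (c : R) :
  dist_integrable d mu x0 -> dist_integrable d nu x0 ->
  (forall f, bounded_measurable (f : borel T -> R) -> lipschitz_wrt d 1 f ->
    \int[mu]_x f x - \int[nu]_x f x <= c)%R ->
  kantorovich_dist d mu nu <= c%:E.
Proof.
move=> imu inu Hc; apply: ge_ereal_sup => _ [f lf <-].
have lf1 : lipschitz_wrt d 1 f by move=> x y; rewrite mul1r; exact: lf.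
have fmu := lipschitz_integrable imu lf1; have fnu := lipschitz_integrable inu lf1.
rewrite -(fineK (integrable_fin_num measurableT fmu)).
rewrite -(fineK (integrable_fin_num measurableT fnu)) -EFinB lee_fin.
apply: (cvgr_to_le (cvgB (trunc_cvg imu lf1) (trunc_cvg inu lf1))).
apply: nearW => n; apply: Hc; last exact: trunc_lipschitz.
by split; [exact: (lipschitz_measurable (@trunc_lipschitz n f lf1))|exact: trunc_bounded].
Qed.

End kantorovich_dist_lemmas.

(** * Transfer of couplings for the Kantorovich pseudometric *)

Section kantorovich_transfer.
Context {R : realType} (I : finType) (X : I -> ptopologicalType).
Context (Z : ptopologicalType) (p : forall i, Z -> X i).
Context (hX : forall i, hausdorff_space (X i)) (hZ : hausdorff_space Z).
Context (cp : forall i, continuous (p i)).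
Context (p_surj : forall x : (forall i, X i), exists z, forall i, p i z = x i).
Context (p_box : forall K : (forall i, set (X i)), (forall i, compact (K i)) ->
  compact [set z | forall i, K i (p i z)]).
Context (a : forall i, X i * X i -> R).
Arguments a : clear implicits.
Context (ca : forall i, continuous (a i)) (pa : forall i, pseudometric (a i)).

Definition marginals (gamma : probability (borel Z) R)
    (mu : forall i, probability (borel (X i)) R) :=
  forall i (A : set (borel (X i))), measurable A -> gamma (p i @^-1` A) = mu i A.

Lemma sum_dist_integrable (gamma : probability (borel Z) R)
    (mu : forall i, probability (borel (X i)) R) (z0 : Z) :
  marginals gamma mu -> (forall i, dist_integrable (a i) (mu i) (p i z0)) ->
  dist_integrable (sum_dist p a) gamma z0.
Proof.
move=> gmu imu.
have mp i : measurable_fun setT (p i : borel Z -> borel (X i)).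
  exact: continuous_borel_measurable.
have iai i : gamma.-integrable setT (fun z => (a i (p i z, p i z0))%:E).
  have [a0 _ _ _] := pa i.
  have /integrableP[mai iai] := imu i.
  apply/integrableP; split; first exact: (measurableT_comp mai).
  rewrite (@ge0_integral_image _ _ _ _ _ gamma (mu i) (p i)
    (fun x => `|(a i (x, p i z0))%:E|)%E) => //.
  - by move=> A mA; exact: gmu.
  - exact: measurableT_comp.
rewrite /dist_integrable /sum_dist.
under eq_fun do rewrite -sumEFin.
exact: integrable_sum.
Qed.

Context (mu nu : forall i, probability (borel (X i)) R).
Context (rnu : forall i, radon (nu i)).
Context (imunu : forall i, exists x0, dist_integrable (a i) (mu i) x0 /\
  dist_integrable (a i) (nu i) x0).

(** Such an [f] is constant; this covers the weight [t = 0] and the zero pseudometric. *)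
Let constant_expectation i (f : X i -> R) : (forall x y, `|f x - f y| <= 0) ->
  \int[mu i]_x f x <= \int[nu i]_x f x.
Proof.
move=> fc; have -> : f = cst (f point).
  by apply/funext => x; apply/eqP; rewrite -subr_eq0 -normr_le0; exact: fc.
by rewrite /cst !expectation_cst.
Qed.

Lemma integrability_base_point : exists z0, forall i,
  dist_integrable (a i) (mu i) (p i z0) /\ dist_integrable (a i) (nu i) (p i z0).
Proof.
pose x0 i := projT1 (cid (imunu i)).
have [z0 z0E] := p_surj x0; exists z0 => i; rewrite z0E /x0.
by case: cid.
Qed.

Lemma kantorovich_transfer (sigma : probability (borel Z) R) :
  marginals sigma mu ->
  exists gamma : probability (borel Z) R, [/\ radon gamma, marginals gamma nu &
    (kantorovich_dist (sum_dist p a) sigma gamma <=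
     \sum_i kantorovich_dist (a i) (mu i) (nu i))%E].
Proof.
move=> smu; have kd0 i := kantorovich_dist_ge0 (pa i) (mu i) (nu i).
have [kdfin|] := pselect (forall i, kantorovich_dist (a i) (mu i) (nu i) \is a fin_num).
  have [|gamma [rg gnu Hg]] := @lipschitz_transfer _ _ _ _ _ hX hZ cp p_surj p_box
    a ca pa mu nu sigma (fun i => fine (kantorovich_dist (a i) (mu i) (nu i))) rnu smu.
    move=> i t f; rewrite le_eqVlt => /predU1P[<-|t0] bf lf.
      rewrite mul0r addr0; apply: constant_expectation => x y.
      by have := lf x y; rewrite mul0r.
    have ti : 0 <= t^-1 by rewrite invr_ge0 ltW.
    have lf' : lipschitz_wrt (a i) 1 (fun x => t^-1 * f x).
      by move=> x y; rewrite -mulrBr normrM (ger0_norm ti) mul1r ler_pdivrMl//; exact: lf.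
    have := kantorovich_dist_ge (mu i) (nu i) (bounded_measurableM t^-1 bf) lf'.
    rewrite -(fineK (kdfin i)) lee_fin !expectationM// -mulrBr ler_pdivrMl//.
    by rewrite lerBlDl.
  exists gamma; split => //.
  have [z0 z0I] := integrability_base_point.
  have -> : (\sum_i kantorovich_dist (a i) (mu i) (nu i) =
      (\sum_i fine (kantorovich_dist (a i) (mu i) (nu i)))%:E)%E.
    by rewrite -sumEFin; apply: eq_bigr => i _; rewrite fineK.
  apply: (kantorovich_dist_le (sum_dist_continuous _ _) (sum_dist_pseudometric _ _)) => //.
  - by apply: sum_dist_integrable smu _ => i; exact: (z0I i).1.
  - by apply: sum_dist_integrable gnu _ => i; exact: (z0I i).2.
(* An infinite term makes the sum infinite, the others being nonnegative. It remains to find a Radon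
   measure with marginals [nu], which the transfer for zero pseudometrics provides. *)
move=> /existsNP[i0 /negP kdinf].
have [|||gamma [rg gnu _]] := @lipschitz_transfer _ _ _ _ _ hX hZ cp p_surj p_box
    (fun i => cst 0) _ _ mu nu sigma (fun=> 0) rnu smu.
- by move=> i z; exact: cvg_cst.
- by move=> i; split => //= x y z; rewrite addr0.
- move=> i t f _ bf lf; rewrite mulr0 addr0; apply: constant_expectation => x y.
  by have := lf x y; rewrite mulr0.
exists gamma; split => //.
rewrite (bigD1 i0)//=.
have -> : kantorovich_dist (a i0) (mu i0) (nu i0) = +oo%E.
  by apply/eqP; move: kdinf; rewrite ge0_fin_numE// ltey negbK.
by rewrite addye ?leey// gt_eqF// (@lt_le_trans _ _ 0%E)// sume_ge0.
Qed.

End kantorovich_transfer.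

(** * Products of two factors *)

Section two_factors.
Context {R : realType} (X Y : ptopologicalType).
Context (hX : hausdorff_space X) (hY : hausdorff_space Y).
Context (alpha : X * X -> R) (beta : Y * Y -> R).
Context (calpha : continuous alpha) (palpha : pseudometric alpha).
Context (cbeta : continuous beta) (pbeta : pseudometric beta).

(** The two factors form a family over [bool], so that [X * Y] becomes an instance of the abstract
    product. *)
Let F (b : bool) : ptopologicalType := if b then X else Y.

Let proj b : X * Y -> F b :=
  match b return X * Y -> F b with true => fst | false => snd end.

Let dist b : F b * F b -> R :=
  match b return F b * F b -> R with true => alpha | false => beta end.

Let pair_measure (mu : probability (borel X) R) (nu : probability (borel Y) R) b :
    probability (borel (F b)) R :=
  match b return probability (borel (F b)) R with true => mu | false => nu end.

Let oplusE : oplus alpha beta = sum_dist proj dist.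
Proof. by apply/funext => q; rewrite /sum_dist big_bool. Qed.

Let coupling_marginals mu nu (sigma : probability (borel (X * Y)%type) R) :
  coupling mu nu sigma <-> radon sigma /\ marginals proj sigma (pair_measure mu nu).
Proof.
split=> [[rs s1 s2]|[rs sm]]; split => //.
- move=> [] A mA.
  + by apply: etrans (s1 A mA); rewrite -preimage_fst.
  + by apply: etrans (s2 A mA); rewrite -preimage_snd.
- by move=> A mA; rewrite -preimage_fst; exact: (sm true).
- by move=> A mA; rewrite -preimage_snd; exact: (sm false).
Qed.

Context (mu1 mu2 : probability (borel X) R) (nu1 nu2 : probability (borel Y) R).
Context (rmu2 : radon mu2) (rnu2 : radon nu2).
Context (imu : exists x0, dist_integrable alpha mu1 x0 /\ dist_integrable alpha mu2 x0).
Context (inu : exists y0, dist_integrable beta nu1 y0 /\ dist_integrable beta nu2 y0).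

Lemma coupling_transfer sigma1 : coupling mu1 nu1 sigma1 ->
  exists2 sigma2, coupling mu2 nu2 sigma2 &
    (kantorovich_dist (oplus alpha beta) sigma1 sigma2 <=
     kantorovich_dist alpha mu1 mu2 + kantorovich_dist beta nu1 nu2)%E.
Proof.
move=> /coupling_marginals[_ sm].
have [|||||||||gamma [rg gm gk]] := @kantorovich_transfer _ _ F _ proj _ _ _ _ _ dist
    _ _ (pair_measure mu1 nu1) (pair_measure mu2 nu2) _ _ sigma1 sm.
- by case.
- exact: hausdorff_prod.
- by case; [exact: continuous_fst|exact: continuous_snd].
- by move=> x; exists (x true, x false); case.
- move=> K cK.
  rewrite (_ : [set _ | _] = K true `*` K false); first exact: (compact_setX (cK true) (cK false)).
  by apply/seteqP; split => [z Kz|z [? ?] []//]; split; [exact: (Kz true)|exact: (Kz false)].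
- by case.
- by case.
- by case.
- by case.
exists gamma; first exact/coupling_marginals.
by rewrite oplusE; move: gk; rewrite big_bool.
Qed.

(** The second half of the Hausdorff distance transfers couplings backwards, with the arguments of
    the distance exchanged. *)
Lemma coupling_dist_sym sigma1 sigma2 : coupling mu1 nu1 sigma1 ->
  coupling mu2 nu2 sigma2 ->
  kantorovich_dist (oplus alpha beta) sigma1 sigma2 =
  kantorovich_dist (oplus alpha beta) sigma2 sigma1.
Proof.
move=> /coupling_marginals[_ s1m] /coupling_marginals[_ s2m].
have [x0 [ix1 ix2]] := imu; have [y0 [iy1 iy2]] := inu.
have cp b : continuous (proj b).
  by case: b; [exact: continuous_fst|exact: continuous_snd].
have cd b : continuous (@dist b) by case: b.
have pd b : pseudometric (@dist b) by case: b.
rewrite oplusE; apply: (@kantorovich_dist_sym _ _ _ _ _ _ _ (x0, y0)).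
- exact: sum_dist_continuous.
- exact: sum_dist_pseudometric.
- by apply: (sum_dist_integrable cp pd s1m); case.
- by apply: (sum_dist_integrable cp pd s2m); case.
Qed.

End two_factors.

(** The abstract transfer for the evaluations of [prod_topology], where compactness of boxes is
    Tychonoff's theorem. *)
Lemma multicoupling_transfer (R : realType) (n : nat) (X : 'I_n -> ptopologicalType)
    (alpha : forall i, X i * X i -> R)
    (mu nu : forall i, probability (borel (X i)) R) :
  (forall i, hausdorff_space (X i)) ->
  (forall i, continuous (@alpha i)) -> (forall i, pseudometric (@alpha i)) ->
  (forall i, radon (nu i)) ->
  (forall i, exists x0, dist_integrable (@alpha i) (mu i) x0 /\
                        dist_integrable (@alpha i) (nu i) x0) ->
  forall sigma, multicoupling mu sigma ->
  exists2 pi, multicoupling nu pi &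
    (kantorovich_dist (multioplus (@alpha)) pi sigma <=
     \sum_(i < n) kantorovich_dist (@alpha i) (mu i) (nu i))%E.
Proof.
move=> hX calpha palpha rnu imunu sigma [_ sm].
pose p i (z : prod_topology X) : X i := z i.
have cp i : continuous (p i) by exact: proj_continuous.
have p_surj (x : forall i, X i) : exists z, forall i, p i z = x i by exists x.
have hZ : hausdorff_space (prod_topology X) by exact: hausdorff_product.
have pm : marginals p sigma mu by exact: sm.
have [gamma [rg gm gk]] := kantorovich_transfer hX hZ cp p_surj
  (@tychonoff _ _) calpha palpha rnu imunu pm.
exists gamma; first by split.
have [z0 z0I] := integrability_base_point p_surj imunu.
(* The transfer bounds the distance from [sigma] to the new measure, whereas the conclusion has them
   in the other order. *)
suff symE : kantorovich_dist (sum_dist p alpha) gamma sigma =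
    kantorovich_dist (sum_dist p alpha) sigma gamma by move: gk; rewrite -symE.
apply: (@kantorovich_dist_sym _ _ _ _ _ _ _ z0).
- exact: sum_dist_continuous.
- exact: sum_dist_pseudometric.
- by apply: (sum_dist_integrable cp palpha gm) => i; exact: (z0I i).2.
- by apply: (sum_dist_integrable cp palpha pm) => i; exact: (z0I i).1.
Qed.

(** * Deduction of the three claims from the transfer lemmas *)

Local Open Scope ereal_scope.

Theorem theorem3p1 (R : realType) :
  (forall X Y : ptopologicalType, tychonoff_space X -> tychonoff_space Y ->
    (forall (mu1 mu2 : probability (borel X) R) (nu : probability (borel Y) R)
       (alpha : X * X -> R) (beta : Y * Y -> R),
       radon mu1 -> radon mu2 -> radon nu ->
       continuous alpha -> (forall p, (0 <= alpha p)%R) ->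
       continuous beta -> (forall p, (0 <= beta p)%R) ->
       (forall y, beta (y, y) = 0%R) ->
       forall sigma1, coupling mu1 nu sigma1 ->
       exists2 sigma2, coupling mu2 nu sigma2 &
         kantorovich_cost (oplus alpha beta) sigma1 sigma2
           <= kantorovich_cost alpha mu1 mu2)
    /\
    (forall (alpha : X * X -> R) (beta : Y * Y -> R)
       (mu1 mu2 : probability (borel X) R) (nu1 nu2 : probability (borel Y) R),
       continuous alpha -> pseudometric alpha ->
       continuous beta -> pseudometric beta ->
       radon mu1 -> radon mu2 -> radon nu1 -> radon nu2 ->
       (exists x0, dist_integrable alpha mu1 x0 /\
                   dist_integrable alpha mu2 x0) ->
       (exists y0, dist_integrable beta nu1 y0 /\
                   dist_integrable beta nu2 y0) ->
       (forall sigma1, coupling mu1 nu1 sigma1 ->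
        exists2 sigma2, coupling mu2 nu2 sigma2 &
          kantorovich_dist (oplus alpha beta) sigma1 sigma2
            <= kantorovich_dist alpha mu1 mu2 + kantorovich_dist beta nu1 nu2)
       /\
       hausdorff_dist (kantorovich_dist (oplus alpha beta))
           (coupling mu1 nu1) (coupling mu2 nu2)
         <= kantorovich_dist alpha mu1 mu2 + kantorovich_dist beta nu1 nu2))
  /\
  (forall (n : nat) (X : 'I_n -> ptopologicalType)
     (alpha : forall i, X i * X i -> R)
     (mu nu : forall i, probability (borel (X i)) R),
     (forall i, tychonoff_space (X i)) ->
     (forall i, continuous (alpha i)) -> (forall i, pseudometric (alpha i)) ->
     (forall i, radon (mu i)) -> (forall i, radon (nu i)) ->
     (forall i, exists x0, dist_integrable (alpha i) (mu i) x0 /\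
                           dist_integrable (alpha i) (nu i) x0) ->
     forall sigma, multicoupling mu sigma ->
     exists2 pi, multicoupling nu pi &
       kantorovich_dist (multioplus alpha) pi sigma
         <= \sum_(i < n) kantorovich_dist (alpha i) (mu i) (nu i)).
Proof.
split=> [X Y [_ hX] [_ hY]|]; first split.
- move=> mu1 mu2 nu alpha beta rmu1 rmu2 rnu calpha alpha0 cbeta beta0 beta_diag.
  by move=> sigma1; exact: cost_transfer.
- move=> alpha beta mu1 mu2 nu1 nu2 calpha palpha cbeta pbeta.
  move=> rmu1 rmu2 rnu1 rnu2 imu inu.
  have transfer12 := coupling_transfer hX hY calpha palpha cbeta pbeta rmu2 rnu2 imu inu.
  split=> //; rewrite /hausdorff_dist ge_max; apply/andP; split.
    apply: ge_ereal_sup => _ [sigma1 csigma1 <-].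
    have [sigma2 csigma2 le12] := transfer12 _ csigma1.
    by apply: le_trans le12; apply: ereal_inf_lbound; exists sigma2.
  (* The other half: the transfer with the roles of the two pairs of marginals exchanged, followed
     by symmetry of all three distances. *)
  have [x0 [ix1 ix2]] := imu; have [y0 [iy1 iy2]] := inu.
  have imu' : exists x0, dist_integrable alpha mu2 x0 /\ dist_integrable alpha mu1 x0.
    by exists x0.
  have inu' : exists y0, dist_integrable beta nu2 y0 /\ dist_integrable beta nu1 y0.
    by exists y0.
  apply: ge_ereal_sup => _ [sigma2 csigma2 <-].
  have [sigma1 csigma1] := coupling_transfer hX hY calpha palpha cbeta pbeta
    rmu1 rnu1 imu' inu' csigma2.
  rewrite (kantorovich_dist_sym calpha palpha ix2 ix1).
  rewrite (kantorovich_dist_sym cbeta pbeta iy2 iy1).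
  rewrite (coupling_dist_sym calpha palpha cbeta pbeta imu' inu' csigma2 csigma1) => le21.
  by apply: le_trans le21; apply: ereal_inf_lbound; exists sigma1.
- move=> n X alpha mu nu tX calpha palpha rmu rnu imunu.
  by apply: multicoupling_transfer => // i; have [] := tX i.
Qed.
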